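(* Let $(G,B)$ be a connected finite graph with boundary equipped with the unit weight such that $G|_\Omega$ is also connected. For $i=2,3,\dots,|\Omega|$ and $j=1,2,\dots,i-1$, let $k=\left\lfloor\frac{|\Omega|}{i-j+1}\right\rfloor$. Then: (1) when $(i-j+1)\nmid|\Omega|$, $$\lambda_i\ge2\left(1-\cos\frac{\pi}{2k+1}\right)+\operatorname{Deg}_B^{(j)}$$ and $$\nu_i\ge2\left(1-\cos\frac{\pi}{2k+1}\right)+\lambda_j\left(\operatorname{Deg}_B\cdot I_\Omega-A_BL_B^{-1}A_\Omega\right);$$ (2) when $(i-j+1)\mid|\Omega|$, $$\lambda_i\ge\lambda_1(P_{k+1},\{0\},m,w)+\operatorname{Deg}_B^{(j)}$$ and $$\nu_i\ge\lambda_1(P_{k+1},\{0\},m,w)+\lambda_j\left(\operatorname{Deg}_B\cdot I_\Omega-A_BL_B^{-1}A_\Omega\right),$$ where $P_{k+1}$ is the path $0\sim1\sim2\sim\dots\sim k$ with boundary $\{0\}$, vertex-measure $m_l=1$ for $l=0,1,\dots,k$, and edge-weights $w_{12}=w_{23}=\dots=w_{k-1,k}=1$ and $w_{01}=\mu_{i-j+1}(P_{i-j+1})$, the largest Laplacian eigenvalue of the path $P_{i-j+1}$ on $i-j+1$ vertices equipped with the unit weight.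
   Context: A weighted finite graph $(G,m,w)$ is a finite simple graph $G$ with vertex set $V$ and edge set $E$, a vertex-measure $m:V\to(0,\infty)$ and an edge-weight $w:E\to(0,\infty)$; $w$ is extended to a symmetric function on $V\times V$ by $w_{xy}=0$ when $\{x,y\}\notin E$. The unit weight means $m\equiv1$ and $w\equiv1$ on $E$. A graph with boundary has in addition a nonempty subset $B\subset V$ (the boundary); $\Omega=V\setminus B$ is the interior and $G|_\Omega$ is the induced subgraph on $\Omega$. $\mathbb{R}^S$ is the space of real functions on $S$, with inner product $\langle u,v\rangle_S=\sum_{x\in S}u(x)v(x)m_x$. For $x\in\Omega$, $\operatorname{Deg}_B(x)=\frac1{m_x}\sum_{y\in B}w_{xy}$; $\operatorname{Deg}_B^{(1)}\le\dots\le\operatorname{Deg}_B^{(|\Omega|)}$ is the nondecreasing rearrangement of these values over $x\in\Omega$; $\operatorname{Deg}_B\cdot I_\Omega$ is multiplication by $\operatorname{Deg}_B$ on $\mathbb{R}^\Omega$. Laplacian: $\Delta u(x)=\frac1{m_x}\sum_{y\in V}(u(x)-u(y))w_{xy}$ for $u\in\mathbb{R}^V$; its eigenvalues, counted with multiplicity, are $0=\mu_1(G)\le\mu_2(G)\le\dots\le\mu_{|V|}(G)$. Dirichlet eigenvalues: for $u\in\mathbb{R}^\Omega$ let $E_0(u)\in\mathbb{R}^V$ be its extension by $0$ on $B$, and $\Delta^Du=(\Delta E_0(u))|_\Omega$, a nonnegative self-adjoint operator on $\mathbb{R}^\Omega$; its eigenvalues, counted with multiplicity, are $0\le\lambda_1\le\dots\le\lambda_{|\Omega|}$,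 also written $\lambda_i(G,B,m,w)$. Neumann Laplacian: for $u\in\mathbb{R}^\Omega$, let $N_0(u)\in\mathbb{R}^V$ be the function with $N_0(u)=u$ on $\Omega$ and $\Delta N_0(u)=0$ on $B$ (unique when $G$ is connected and $\Omega\ne\emptyset$). Set $\Delta^N u=(\Delta N_0(u))|_\Omega$, a nonnegative self-adjoint operator on $\mathbb{R}^\Omega$ with eigenvalues (Neumann eigenvalues), counted with multiplicity, $0\le\nu_1\le\dots\le\nu_{|\Omega|}$. Weighted adjacency operators: $A_B:\mathbb{R}^B\to\mathbb{R}^\Omega$, $A_Bu(x)=\frac1{m_x}\sum_{y\in B}u(y)w_{xy}$ for $x\in\Omega$, and $A_\Omega:\mathbb{R}^\Omega\to\mathbb{R}^B$, $A_\Omega u(x)=\frac1{m_x}\sum_{y\in\Omega}u(y)w_{xy}$ for $x\in B$. $L_B:\mathbb{R}^B\to\mathbb{R}^B$ is $L_Bf=(\Delta\tilde f)|_B$, where $\tilde f$ is the extension of $f$ by $0$ on $\Omega$; it is invertible when $G$ is connected and $\Omega\ne\emptyset$. For a self-adjoint operator $T$, $\lambda_1(T)\le\lambda_2(T)\le\cdots$ are its eigenvalues counted with multiplicity. *)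

(* Defs.v *)
From HB Require Import structures.
From mathcomp Require Import all_boot all_order all_algebra.
From mathcomp Require Import boolp classical_sets reals trigo.

Set Implicit Arguments.
Unset Strict Implicit.
Unset Printing Implicit Defensive.

Import Order.TTheory GRing.Theory Num.Theory.

Local Open Scope ring_scope.

(* A finite simple graph is a symmetric irreflexive [rel T] on a finType. *)

Definition connected_graph (T : finType) (e : rel T) : Prop :=
  forall x y : T, connect e x y.

Notation sub_of S := {x | x \in S}.

Definition induced (V : finType) (e : rel V) (S : {set V}) : rel (sub_of S) :=
  fun x y => e (val x) (val y).

Arguments induced {V} e S.

(* The vertices of [path_rel n] are 0, ..., n-1. *)
Definition path_rel (n : nat) : rel 'I_n :=
  fun x y => (x.+1 == y :> nat) || (y.+1 == x :> nat).

(* R^T; the regular module R^o makes it a finite-dimensional R-vector space. *)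
Notation fspace R T := {ffun T -> R^o}.

Section Spectrum.
Variables (R : realType) (vT : vectType R) (T : 'End(vT)).

Definition is_spectrum (s : seq R) : Prop :=
  sorted <=%R s /\ forall a, count_mem a s = \dim (passmx.leigenspace T a).

(* The eigenvalues in nondecreasing order, each repeated as many times as the
   dimension of its eigenspace. *)
Definition spectrum : seq R := xget [::] is_spectrum.

(* Eigenvalues are numbered from 1. *)
Definition eig (i : nat) : R := nth 0 spectrum i.-1.

Lemma is_spectrum_ex : exists s, is_spectrum s.
Proof.
have [r rP] : exists r : seq R, forall a, passmx.leigenspace T a != 0%VS -> a \in r.
  pose b := vbasis {:vT}.
  have bb : basis_of {:vT} b by exact: vbasisP.
  pose p := char_poly (passmx.mxof b b T).
  have p0 : p != 0 by rewrite monic_neq0 // char_poly_monic.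
  have [r rP] : exists r : seq R, forall a, root p a -> a \in r.
    have [n] := ubnP (size p); elim: n p p0 => // n IH p p0 pn.
    have [[a pa]|npa] := pselect (exists a, root p a); last first.
      by exists [::] => a pa; case: npa; exists a.
    have [q qE] := factor_theorem _ _ pa.
    have q0 : q != 0 by apply: contraNneq p0 => q0; rewrite qE q0 mul0r.
    have [|r rP] := IH q q0.
      by move: pn; rewrite qE size_Mmonic ?monicXsubC // size_XsubC addn2.
    exists (a :: r) => c; rewrite qE rootM root_XsubC in_cons => /orP[/rP->|->] //.
    by rewrite orbT.
  exists r => a Ta; apply: rP; rewrite -eigenvalue_root_char.
  apply: contraNneq Ta => E0; rewrite (passmx.leigenspaceE bb) E0.
  by rewrite passmx.vsof_eq0.
pose f a := nseq (\dim (passmx.leigenspace T a)) a.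
exists (sort <=%R (flatten (map f (undup r)))); split.
  exact: sort_le_sorted.
move=> a; rewrite count_sort count_flatten -map_comp sumnE big_map.
have [ar|ar] := boolP (a \in undup r); last first.
  rewrite big_seq big1 => [|c cr].
    by apply/esym/eqP; rewrite dimv_eq0; apply: contraNT ar => /rP; rewrite mem_undup.
  by rewrite /= count_nseq /=; case: eqP => // ca; rewrite -ca cr in ar.
rewrite (bigD1_seq a) ?undup_uniq //= count_nseq /= eqxx mul1n big1 ?addn0 // => c ca.
by rewrite count_nseq /= (negbTE ca).
Qed.

Lemma is_spectrum_uniq s1 s2 : is_spectrum s1 -> is_spectrum s2 -> s1 = s2.
Proof.
move=> [s1s c1] [s2s c2]; apply: (sorted_eq le_trans le_anti s1s s2s).
by apply/allP => a _ /=; rewrite c1 c2.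
Qed.

Lemma spectrumP : is_spectrum spectrum.
Proof. exact: xgetPex is_spectrum_ex. Qed.

End Spectrum.

Section Operators.
Variables (R : realType) (V : finType) (m : V -> R) (w : V -> V -> R).
Implicit Types S : {set V}.

Definition lapl (u : V -> R) (x : V) : R :=
  (m x)^-1 * \sum_y (u x - u y) * w x y.

Definition laplace_fun (u : fspace R V) : fspace R V := [ffun x => lapl u x].

Fact laplace_fun_linear : linear laplace_fun.
Proof.
move=> a u v; apply/ffunP => x; rewrite !ffunE /lapl.
rewrite [RHS](_ : _ = (m x)^-1 * (a * \sum_y ((u x : R) - u y) * w x y
  + \sum_y ((v x : R) - v y) * w x y)); last by rewrite mulrDr mulrCA.
congr (_ * _); rewrite mulr_sumr -big_split; apply: eq_bigr => y _ /=.
rewrite !ffunE [LHS](_ : _ = ((a * u x + v x) - (a * u y + v y)) * w x y) //.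
by rewrite mulrA -mulrDl mulrBr opprD addrACA.
Qed.

HB.instance Definition _ :=
  GRing.isLinear.Build R (fspace R V) (fspace R V) _ laplace_fun
    laplace_fun_linear.

Definition laplace : 'End(fspace R V) := linfun laplace_fun.

Definition ext0 S (u : fspace R (sub_of S)) : fspace R V :=
  [ffun x => if insub x is Some y then u y else 0].

Definition restr S (u : fspace R V) : fspace R (sub_of S) :=
  [ffun x => u (val x)].

Definition ext_laplace_fun S (u : fspace R (sub_of S)) : fspace R (sub_of S) :=
  restr S (laplace_fun (ext0 u)).

Fact ext_laplace_fun_linear S : linear (@ext_laplace_fun S).
Proof.
move=> a u v.
have ->: ext_laplace_fun (a *: u + v)
       = restr S (laplace_fun (a *: ext0 u + ext0 v)).
  congr (restr S (laplace_fun _)); apply/ffunP => x; rewrite !ffunE.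
  by case: insubP => [y _ _|_]; rewrite ?ffunE ?scaler0 ?addr0.
by rewrite linearP; apply/ffunP => x; rewrite !ffunE.
Qed.

HB.instance Definition _ S :=
  GRing.isLinear.Build R (fspace R (sub_of S)) (fspace R (sub_of S)) _
    (@ext_laplace_fun S) (@ext_laplace_fun_linear S).

(* u |-> (Delta u~)|_S, with u~ the extension of u by 0 outside S: this is
   Delta^D for S the interior, and L_B for S = B. *)
Definition ext_laplace S : 'End(fspace R (sub_of S)) :=
  linfun (@ext_laplace_fun S).

Definition adjf S (u : sub_of S -> R) (x : V) : R :=
  (m x)^-1 * \sum_(y : sub_of S) u y * w x (val y).

Definition adj_fun S S' (u : fspace R (sub_of S)) : fspace R (sub_of S') :=
  [ffun x => adjf u (val x)].

Fact adj_fun_linear S S' : linear (@adj_fun S S').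
Proof.
move=> a u v; apply/ffunP => x; rewrite !ffunE /adjf.
rewrite [RHS](_ : _ = (m (val x))^-1 *
    (a * \sum_(y : sub_of S) (u y : R) * w (val x) (val y)
  + \sum_(y : sub_of S) (v y : R) * w (val x) (val y)));
  last by rewrite mulrDr mulrCA.
congr (_ * _); rewrite mulr_sumr -big_split; apply: eq_bigr => y _ /=.
rewrite !ffunE [LHS](_ : _ = (a * u y + v y) * w (val x) (val y)) //.
by rewrite mulrA -mulrDl.
Qed.

HB.instance Definition _ S S' :=
  GRing.isLinear.Build R (fspace R (sub_of S)) (fspace R (sub_of S')) _
    (@adj_fun S S') (@adj_fun_linear S S').

(* [adj S S'] maps R^S to R^S': A_B is [adj B (~: B)] and A_Omega is
   [adj (~: B) B]. *)
Definition adj S S' : 'Hom(fspace R (sub_of S), fspace R (sub_of S')) :=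
  linfun (@adj_fun S S').

Definition mul_fun (T : finType) (d u : fspace R T) : fspace R T :=
  [ffun x => (d x : R) * (u x : R)].

Fact mul_fun_linear (T : finType) (d : fspace R T) : linear (mul_fun d).
Proof.
move=> a u v; apply/ffunP => x; rewrite !ffunE.
rewrite [LHS](_ : _ = (d x : R) * (a * (u x : R) + (v x : R))) //.
by rewrite mulrDr mulrCA.
Qed.

HB.instance Definition _ (T : finType) (d : fspace R T) :=
  GRing.isLinear.Build R (fspace R T) (fspace R T) _ (mul_fun d)
    (mul_fun_linear d).

Definition mul_op (T : finType) (d : fspace R T) : 'End(fspace R T) :=
  linfun (mul_fun d).

Variable B : {set V}.

Definition degB : fspace R (sub_of (~: B)) :=
  [ffun x => (m (val x))^-1 * \sum_(y in B) w (val x) y].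

(* Deg_B^{(j)}, numbered from 1. *)
Definition degB_sorted (j : nat) : R := nth 0 (sort <=%R (codom degB)) j.-1.

Definition dirichlet_laplace : 'End(fspace R (sub_of (~: B))) :=
  ext_laplace (~: B).

Definition is_N0 (u : fspace R (sub_of (~: B))) (v : fspace R V) : Prop :=
  restr (~: B) v = u /\ forall x, x \in B -> lapl v x = 0.

(* [N0 u] is the unique solution when the graph is connected and B is not the
   whole of V; it is then linear in u, as [linfun] below requires. *)
Definition N0 (u : fspace R (sub_of (~: B))) : fspace R V := xget 0 (is_N0 u).

Definition neumann_fun (u : fspace R (sub_of (~: B))) :
    fspace R (sub_of (~: B)) :=
  restr (~: B) (laplace_fun (N0 u)).

Definition neumann_laplace : 'End(fspace R (sub_of (~: B))) :=
  linfun neumann_fun.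

(* Deg_B I_Omega - A_B L_B^-1 A_Omega. *)
Definition deg_adj_op : 'End(fspace R (sub_of (~: B))) :=
  mul_op degB
  - (adj B (~: B) \o ((ext_laplace B)^-1 \o adj (~: B) B))%VF.

Definition mu (i : nat) : R := eig laplace i.
Definition lambda (i : nat) : R := eig dirichlet_laplace i.
Definition nu (i : nat) : R := eig neumann_laplace i.

End Operators.

Definition unit_measure (R : realType) (V : finType) (x : V) : R := 1.

Definition unit_weight (R : realType) (V : finType) (e : rel V) (x y : V) : R :=
  (e x y)%:R.

(* The edge {0, 1} has weight c, all other edges of the path have weight 1. *)
Definition path_weight (R : realType) (c : R) (n : nat) (x y : 'I_n) : R :=
  if path_rel x y then
    if (minn x y == 0)%N then c else 1
  else 0.

(* Main.v *)
Require Import Defs.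
From HB Require Import structures.
From mathcomp Require Import all_boot all_order all_algebra.
From mathcomp Require boolp classical_sets.
From mathcomp Require Import reals trigo.
From mathcomp Require Import complex ring lra zify.

(* Both operators are the Laplacian of the interior graph plus a symmetric
   operator Y, so by Courant-Fischer it suffices to find n - 1 = i - j linear
   conditions under which the energy of f on a connected graph with N vertices
   is at least a |f|^2; adding the j - 1 conditions given by the lowest
   eigenvectors of Y gives the bound (Weyl's inequality).

   The conditions (a form of Friedman's theorem) come from cutting the graph,
   branch by branch, into few small connected pieces. The energy of a connected
   piece with at most k vertices is bounded below by that of a path: list the
   values |f| in increasing order; every gap between consecutive values is
   crossed by an edge. If n does not divide N, imposing f = 0 at n - 1 vertices
   leaves pieces of size at most k = floor(N / n). If N = nk, then either
   fewer vertices are needed to reach pieces of size less than k, or the graph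
   falls into n connected pieces of size exactly k; the n - 1 edges between them
   are then cut at interior points whose position is dictated by the top
   eigenvector of the path P_n, and each piece is attached to these zeros with
   total weight at least 2 + 2 cos (pi / n), which is at least the top
   eigenvalue of P_n. *)

Set Implicit Arguments.
Unset Strict Implicit.
Unset Printing Implicit Defensive.

Import Order.TTheory GRing.Theory Num.Theory.

Local Open Scope ring_scope.

(** * Symmetric operators and their eigenvalues *)

Section RealEigen.
Variable R : rcfType.

Let toC := real_complex R.

(** Over the complex numbers the characteristic polynomial has a root x + iy; u and v are the real
    and imaginary parts of a corresponding eigenvector. *)
Lemma complex_eigenvector (d : nat) (A : 'M[R]_d.+1) :
  exists (x y : R) (u v : 'rV[R]_d.+1), (u != 0) || (v != 0) /\
    u *m A = x *: u - y *: v /\ v *m A = y *: u + x *: v.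
Proof.
have [z zr] : exists z, root (char_poly (map_mx toC A)) z.
  apply/closed_rootP; rewrite size_char_poly //.
move: zr; rewrite -eigenvalue_root_char => /eigenvalueP[w wA w0].
pose re := map_mx (@complex.Re R); pose im := map_mx (@complex.Im R).
exists (complex.Re z), (complex.Im z), (re _ _ w), (im _ _ w); split.
  apply: contraNT w0; rewrite negb_or !negbK => /andP[/eqP r0 /eqP i0].
  apply/eqP/rowP => k; move/rowP/(_ k): r0; move/rowP/(_ k): i0.
  by rewrite !mxE; case: (w 0 k) => a b /= -> ->.
have wAk k : \sum_j w 0 j * (A j k)%:C%C = z * w 0 k.
  move/rowP/(_ k): wA; rewrite !mxE => <-; apply: eq_bigr => j _;
    rewrite !mxE //.
have ReS (F : 'I_d.+1 -> R[i]) : complex.Re (\sum_j F j) = \sum_j complex.Re (F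
  j).
  exact: raddf_sum.
have ImS (F : 'I_d.+1 -> R[i]) : complex.Im (\sum_j F j) = \sum_j complex.Im (F
  j).
  exact: raddf_sum.
split; apply/rowP => k; rewrite !mxE.
  transitivity (complex.Re (z * w 0 k));
    last by case: z {wA wAk} (w 0 k) => a b [c e] /=.
  rewrite -wAk ReS; apply: eq_bigr => j _; rewrite !mxE.
  by case: (w 0 j) => a b /=; rewrite mulr0 subr0.
transitivity (complex.Im (z * w 0 k)).
  rewrite -wAk ImS; apply: eq_bigr => j _; rewrite !mxE.
  by case: (w 0 j) => a b /=; rewrite mulr0 add0r.
by case: z {wA wAk} (w 0 k) => a b [c e] /=; ring.
Qed.

Lemma complex_eigenvector_end (vT : vectType R) (T : 'End(vT)) :
  (0 < \dim {:vT})%N ->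
  exists (x y : R) (u v : vT), (u != 0) || (v != 0) /\
    T u = x *: u - y *: v /\ T v = y *: u + x *: v.
Proof.
pose b := vbasis {:vT}.
have bb : basis_of {:vT} b by exact: vbasisP.
have bf := basis_free bb.
pose A := passmx.mxof b b T.
(* The dimension is generalized to [d] so that it can take the successor form that
   [complex_eigenvector] requires. *)
have : forall d (E : \dim {:vT} = d),
  (0 < d)%N -> exists (x y : R) (u v : 'rV[R]_(\dim {:vT})),
    (u != 0) || (v != 0) /\
    u *m A = x *: u - y *: v /\ v *m A = y *: u + x *: v.
  move: A; case: (\dim _) => [|d] A d' <- // _; exact: complex_eigenvector.
move=> /(_ _ erefl) H /H [x [y [u [v [uv [Au Av]]]]]].
exists x, y, (passmx.vecof b u), (passmx.vecof b v).
rewrite !passmx.vecof_eq0 //; split=> //.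
have app w : T (passmx.vecof b w) = passmx.vecof b (w *m A).
  by rewrite passmx.mul_mxof ?passmx.rVofK.
have vl : linear (passmx.vecof b) := passmx.vecof_linear b.
have v0 : passmx.vecof b 0 = 0 by apply/eqP; rewrite passmx.vecof_eq0.
have vZ a w : passmx.vecof b (a *: w) = a *: passmx.vecof b w.
  by rewrite -[a *: w]addr0 vl v0 addr0.
by split; rewrite app ?Au ?Av; [rewrite -scaleNr vl vZ scaleNr | rewrite vl vZ].
Qed.

End RealEigen.

(** * Inner product and orthonormal families *)

Section InnerProduct.
Variables (R : realType) (I : finType).
Implicit Types (f g u v : fspace R I) (L : seq (fspace R I)).

Definition ip u v : R := \sum_x (u x : R) * (v x : R).

Lemma ipC u v : ip u v = ip v u.
Proof. by apply: eq_bigr => x _; rewrite mulrC. Qed.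

Lemma ipDr u v w : ip u (v + w) = ip u v + ip u w.
Proof.
rewrite /ip -big_split; apply: eq_bigr => x _ /=; rewrite ffunE.
exact: (mulrDr (u x : R)).
Qed.

Lemma ipZr a u v : ip u (a *: v) = a * ip u v.
Proof.
rewrite /ip mulr_sumr; apply: eq_bigr => x _ /=; rewrite ffunE.
exact: (mulrCA (u x : R)).
Qed.

Lemma ipZl a u v : ip (a *: u) v = a * ip u v.
Proof. by rewrite ipC ipZr ipC. Qed.

Lemma ipDl u v w : ip (u + v) w = ip u w + ip v w.
Proof. by rewrite ipC ipDr !(ipC w). Qed.

Lemma ipNr u v : ip u (- v) = - ip u v.
Proof. by rewrite -scaleN1r ipZr mulN1r. Qed.

Lemma ipNl u v : ip (- u) v = - ip u v.
Proof. by rewrite ipC ipNr ipC. Qed.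

Lemma ip0r u : ip u 0 = 0.
Proof. by rewrite -(scale0r 0) ipZr mul0r. Qed.

Lemma ip_sumr (J : Type) (r : seq J) (P : pred J) (F : J -> fspace R I) u :
  ip u (\sum_(i <- r | P i) F i) = \sum_(i <- r | P i) ip u (F i).
Proof. by elim/big_rec2: _ => [|i y1 y2 _ <-]; rewrite ?ip0r ?ipDr. Qed.

Lemma ip_suml (J : Type) (r : seq J) (P : pred J) (F : J -> fspace R I) u :
  ip (\sum_(i <- r | P i) F i) u = \sum_(i <- r | P i) ip (F i) u.
Proof. by rewrite ipC ip_sumr; apply: eq_bigr => i _; rewrite ipC. Qed.

Lemma ip_ge0 u : 0 <= ip u u.
Proof. by apply: sumr_ge0 => x _; rewrite -expr2 sqr_ge0. Qed.

Lemma ip_eq0 u : (ip u u == 0) = (u == 0).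
Proof.
apply/idP/eqP => [|->]; last by rewrite ip0r.
rewrite psumr_eq0 => [/allP u0|x _]; last by rewrite -expr2 sqr_ge0.
apply/ffunP => x; rewrite ffunE.
by have /u0 := mem_index_enum x; rewrite /= mulf_eq0 orbb => /eqP.
Qed.

Lemma ip_gt0 u : u != 0 -> 0 < ip u u.
Proof. by move=> u0; rewrite lt_def ip_eq0 u0 ip_ge0. Qed.

Definition delta (x : I) : fspace R I := [ffun y => (x == y)%:R].

Lemma ip_delta x u : ip (delta x) u = u x.
Proof.
rewrite /ip (bigD1 x) //= ffunE eqxx mul1r big1 ?addr0 // => y yx.
by rewrite ffunE eq_sym (negPf yx) mul0r.
Qed.

Definition orth L f := all (fun g => ip g f == 0) L.

Lemma orthP L f : reflect {in L, forall g, ip g f = 0} (orth L f).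
Proof. by apply: (iffP allP) => H g /H /eqP. Qed.

Lemma orth_cat L1 L2 f : orth (L1 ++ L2) f = orth L1 f && orth L2 f.
Proof. exact: all_cat. Qed.

(** A homogeneous linear system with fewer equations than unknowns has a nonzero solution. *)
Lemma exists_orth L : (size L < #|I|)%N -> exists2 f, f != 0 & orth L f.
Proof.
move=> sL; pose M := \matrix_(i < #|I|, l < size L) (L`_l (enum_val i) : R).
have : kermx M != 0.
  by rewrite kermx_eq0 -row_leq_rank -ltnNge (leq_ltn_trans (rank_leq_col M)).
move=> /rowV0Pn[c /sub_kermxP cM c0].
exists [ffun x => c 0 (enum_rank x)].
  apply: contraNneq c0 => /ffunP c0; apply/eqP/rowP => i.
  by have := c0 (enum_val i); rewrite !ffunE enum_valK !mxE.
apply/(all_nthP 0) => l lL; move/rowP/(_ (Ordinal lL)): cM; rewrite !mxE => cM.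
rewrite -[X in _ == X]cM; apply/eqP.
rewrite /ip (reindex_onto _ _ (in1W (@enum_rankK I))) /=.
rewrite (eq_bigl xpredT) => [|i]; last by rewrite enum_valK eqxx.
by apply: eq_bigr => i _; rewrite !ffunE enum_valK !mxE mulrC.
Qed.

(** Since the family is indexed by [I] itself, its matrix [M] is square with [M *m M^T = 1], hence
    invertible; it kills the remainder [g], which is therefore 0. *)
Lemma orthonormal_expansion (b : I -> fspace R I) :
  (forall i j, ip (b i) (b j) = (i == j)%:R) ->
  forall f, f = \sum_i ip (b i) f *: b i.
Proof.
move=> bE f; apply/eqP; rewrite -subr_eq0; set g := f - _.
have gb i : ip (b i) g = 0.
  rewrite ipDr ipNr ip_sumr (bigD1 i) //= ipZr bE eqxx mulr1 big1 ?addr0 ?subrr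
    //.
  by move=> j ji; rewrite ipZr bE eq_sym (negPf ji) mulr0.
pose M := \matrix_(i < #|I|, j < #|I|) (b (enum_val i) (enum_val j) : R).
have enum_sum (F : I -> R) : \sum_x F x = \sum_(k < #|I|) F (enum_val k).
  rewrite (reindex_onto _ _ (in1W (@enum_rankK I))) /=.
  by apply: eq_bigl => i; rewrite enum_valK eqxx.
have MM : M *m M^T = 1%:M.
  apply/matrixP => i j; rewrite !mxE -(inj_eq enum_val_inj) -bE /ip enum_sum.
  by apply: eq_bigr => k _; rewrite !mxE.
have Mu : M \in unitmx by case: (mulmx1_unit MM).
pose c := \col_(k < #|I|) (g (enum_val k) : R).
have c0 : c = 0.
  suff Mc : M *m c = 0 by rewrite -[c](mulKmx Mu) Mc mulmx0.
  apply/colP => i; rewrite !mxE -[RHS](gb (enum_val i)) /ip enum_sum.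
  by apply: eq_bigr => k _; rewrite !mxE.
apply/eqP/ffunP => x; rewrite [RHS]ffunE.
by move/colP/(_ (enum_rank x)): c0; rewrite !mxE enum_rankK.
Qed.

End InnerProduct.

(** * Spectral theorem and Courant-Fischer bounds *)

Section SymmetricOperators.
Variables (R : realType) (I : finType).
Implicit Types (f g u v : fspace R I) (L : seq (fspace R I)).

Definition orth_fun L f : fspace R 'I_(size L) := [ffun l : 'I_(size L) =>
  ip L`_l f].

Fact orth_fun_linear L : linear (orth_fun L).
Proof. by move=> a u v; apply/ffunP => l; rewrite !ffunE ipDr ipZr. Qed.

HB.instance Definition _ L :=
  GRing.isLinear.Build R (fspace R I) (fspace R 'I_(size L)) _ (orth_fun L)
    (@orth_fun_linear L).

Lemma mem_orth L f : (f \in lker (linfun (orth_fun L))) = orth L f.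
Proof.
rewrite memv_ker lfunE /=; apply/eqP/(all_nthP 0) => [/ffunP f0 l lL|f0].
  by have := f0 (Ordinal lL); rewrite !ffunE => /eqP.
by apply/ffunP => l; rewrite !ffunE; apply/eqP/f0.
Qed.

Definition symmetric_op (T : 'End(fspace R I)) :=
  forall u v, ip (T u) v = ip u (T v).

(** By symmetry [T] preserves the orthogonal complement [W] of a family of eigenvectors, and [W] is
    nonzero by dimension, so the restriction of [T] to [W] has an eigenvector. *)
Lemma eigenvector_orth (T : 'End(fspace R I)) L : symmetric_op T ->
  {in L, forall g, exists a : R, T g = a *: g} -> (size L < #|I|)%N ->
  exists b (a : R), [/\ ip b b = 1, orth L b & T b = a *: b].
Proof.
move=> symT eigL sL; pose W := lker (linfun (orth_fun L)).
have TW f : f \in W -> T f \in W.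
  rewrite !mem_orth => /orthP Lf; apply/orthP => g gL.
  by rewrite -symT; have [a ->] := eigL g gL; rewrite ipZl Lf ?mulr0.
have [f0 f0n f0L] := exists_orth sL.
pose T' : 'End(subvs_of W) := (linfun (vsproj W) \o (T \o linfun vsval))%VF.
have T'E (u : subvs_of W) : vsval (T' u) = T (vsval u).
  by rewrite !comp_lfunE !lfunE /= vsprojK ?TW ?subvsP.
have dW : (0 < \dim {:subvs_of W})%N.
  rewrite lt0n dimv_eq0; apply: contraNneq f0n => W0.
  have := memvf (vsproj W f0); rewrite W0 memv0 => /eqP /(congr1 vsval).
  by rewrite vsprojK ?mem_orth // => ->.
have [x [y [u [v [uv [Tu Tv]]]]]] := complex_eigenvector_end T' dW.
have {}Tu : T (vsval u) = x *: (vsval u : fspace R I) - y *: (vsval v : fspace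
  R I).
  by rewrite -T'E Tu linearB !linearZ.
have {}Tv : T (vsval v) = y *: (vsval u : fspace R I) + x *: (vsval v : fspace
  R I).
  by rewrite -T'E Tv linearD !linearZ.
have: (vsval u != 0) || (vsval v != 0).
  by move: uv; rewrite -!(inj_eq val_inj).
move: Tu Tv (subvsP u) (subvsP v).
move: (vsval u : fspace R I) (vsval v : fspace R I) => {uv}u {}v Tu Tv.
rewrite !mem_orth => Lu Lv uv.
(* Comparing <Tu, v> with <u, Tv> shows that the eigenvalue x + iy is real. *)
have y0 : y = 0.
  have := symT u v; rewrite Tu Tv ipDl ipDr ipNl !ipZl !ipZr => E.
  have : y * (ip u u + ip v v) = 0 by lra.
  move=> /eqP; rewrite mulf_eq0 => /orP[/eqP //|].
  by rewrite paddr_eq0 ?ip_ge0 // !ip_eq0 -[_ && _]negbK negb_and uv.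
have [w [w0 Lw Tw]] : exists w, [/\ w != 0, orth L w & T w = x *: w].
  have [un|un] := boolP (u != 0).
    by exists u; split => //; rewrite Tu y0 scale0r subr0.
  exists v; split => //; first by rewrite (negPf un) in uv.
  by rewrite Tv y0 scale0r add0r.
exists ((Num.sqrt (ip w w))^-1 *: w), x; split.
- rewrite ipZl ipZr mulrA -expr2 exprVn sqr_sqrtr ?ip_ge0 // mulVf //.
  by rewrite ip_eq0.
- by apply/orthP => g /(orthP _ _ Lw) gw; rewrite ipZr gw mulr0.
- by rewrite linearZ /= Tw !scalerA mulrC.
Qed.

Definition orthonormal (J : finType) (b : J -> fspace R I) :=
  forall i j, ip (b i) (b j) = (i == j)%:R.

Lemma exists_eigenbasis (T : 'End(fspace R I)) : symmetric_op T ->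
  exists (b : I -> fspace R I) (a : I -> R),
    orthonormal b /\ forall x, T (b x) = a x *: b x.
Proof.
move=> symT.
have : forall d, (d <= #|I|)%N -> exists L, [/\ size L = d,
    forall i j, (i < d)%N -> (j < d)%N -> ip L`_i L`_j = (i == j)%:R &
    {in L, forall g, exists a : R, T g = a *: g}].
  elim=> [|d IH] dI; first by exists [::].
  have [L [sL Lip LT]] := IH (ltnW dI).
  have [|b [a [b1 Lb Tb]]] := eigenvector_orth symT LT; first by rewrite sL.
  exists (rcons L b); split; first by rewrite size_rcons sL.
    have Lb0 i : (i < d)%N -> ip L`_i b = 0.
      by move=> id; apply: (orthP _ _ Lb); rewrite mem_nth // sL.
    move=> i j; rewrite !nth_rcons sL !ltnS (leq_eqVlt i) (leq_eqVlt j).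
    case/orP=> [/eqP ->|id]; case/orP=> [/eqP ->|jd];
      rewrite ?ltnn ?eqxx ?id ?jd.
    - by [].
    - by rewrite ipC Lb0 // (gtn_eqF jd).
    - by rewrite Lb0 // (ltn_eqF id).
    - exact: Lip.
  move=> g; rewrite mem_rcons in_cons => /orP[/eqP ->|/LT //].
  by exists a.
move=> /(_ _ (leqnn _))[L [sL Lip LT]].
pose b (x : I) : fspace R I := L`_(enum_rank x).
have /boolp.choice[a aP] (x : I) : exists a : R, T (b x) = a *: b x.
  by apply: LT; rewrite mem_nth // sL.
exists b, a; split=> // x y.
by rewrite Lip // (inj_eq val_inj) (inj_eq enum_rank_inj).
Qed.

Section Eigenbasis.
Variables (T : 'End(fspace R I)) (b : I -> fspace R I) (a : I -> R).
Hypotheses (b_on : orthonormal b) (Tb : forall x, T (b x) = a x *: b x).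

(** The eigenspace of [c] is spanned by the [b x] with [a x = c]: pairing [T f = c *: f] with [b x]
    gives [(a x - c) * ip (b x) f = 0]. These vectors are free, so their number is the multiplicity
    of [c]. *)
Lemma spectrum_eigenbasis : spectrum T = sort <=%R (codom a).
Proof.
apply: (is_spectrum_uniq (spectrumP T)); split; first exact: sort_le_sorted.
move=> c; rewrite count_sort.
pose s := [seq x <- enum I | a x == c]; pose X := [seq b x | x <- s].
have xs x : (x \in s) = (a x == c) by rewrite mem_filter mem_enum andbT.
have us : uniq s by rewrite filter_uniq // enum_uniq.
have -> : passmx.leigenspace T c = <<X>>%VS.
  apply/eqP; rewrite eqEsubv; apply/andP; split; last first.
    apply/span_subvP => g /mapP[x]; rewrite xs => /eqP axc ->.
    by rewrite memv_ker !lfun_simp Tb axc subrr.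
  apply/subvP => f; rewrite memv_ker !lfun_simp subr_eq0 => /eqP Tf.
  have fx x : a x != c -> ip (b x) f = 0.
    move=> axc; have : (a x - c) * ip (b x) f = 0.
      have := Tf; rewrite [in LHS](orthonormal_expansion b_on f).
      move=> /(congr1 (ip (b x))).
      rewrite linear_sum ip_sumr (bigD1 x) //= linearZ /= Tb !ipZr b_on eqxx.
      rewrite big1 => [|y yx]; last first.
        by rewrite linearZ /= Tb !ipZr b_on eq_sym (negPf yx) !mulr0.
      by rewrite addr0 mulr1 => E; rewrite mulrBl (mulrC _ (ip _ _)) E subrr.
    by move=> /eqP; rewrite mulf_eq0 subr_eq0 (negPf axc) => /eqP.
  rewrite [f](orthonormal_expansion b_on) rpred_sum // => x _.
  have [axc|/fx ->] := boolP (a x == c); last by rewrite scale0r mem0v.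
  by rewrite rpredZ // memv_span // map_f // xs.
have -> : \dim <<X>>%VS = size X.
  apply/eqP; change (free (in_tuple X)); apply/freeP => k k0 i.
  have si : (i < size s)%N by rewrite -(size_map b) ltn_ord.
  have [x0 _] : exists x0 : I, true by case: (s) si => // x0 *; exists x0.
  move/(congr1 (ip (b (nth x0 s i)))): k0; rewrite ip0r ip_sumr (bigD1 i) //=.
  rewrite (nth_map x0) // ipZr b_on eqxx mulr1 big1 ?addr0 // => l li.
  have sl : (l < size s)%N by rewrite -(size_map b) ltn_ord.
  by rewrite (nth_map x0) // ipZr b_on nth_uniq // eq_sym (inj_eq val_inj)
    (negPf li) mulr0.
by rewrite size_map size_filter /codom /image_mem count_map.
Qed.

Lemma ip_eigenbasis f : ip f f = \sum_x ip (b x) f ^+ 2.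
Proof.
rewrite [X in ip X _](orthonormal_expansion b_on f) ip_suml.
by apply: eq_bigr => x _; rewrite ipZl -expr2.
Qed.

Lemma ip_op_eigenbasis f : ip (T f) f = \sum_x a x * ip (b x) f ^+ 2.
Proof.
rewrite [X in T X](orthonormal_expansion b_on f) linear_sum ip_suml.
by apply: eq_bigr => x _; rewrite linearZ /= Tb !ipZl expr2 mulrCA.
Qed.

End Eigenbasis.

Lemma size_spectrum (T : 'End(fspace R I)) :
  symmetric_op T -> size (spectrum T) = #|I|.
Proof.
move=> symT; have [b [a [b_on Tb]]] := exists_eigenbasis symT.
by rewrite (spectrum_eigenbasis b_on Tb) size_sort size_codom.
Qed.

Lemma leq_nth_sorted (s : seq R) i j : sorted <=%R s -> (i <= j < size s)%N ->
  nth 0 s i <= nth 0 s j.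
Proof.
move=> ss /andP[ij js]; apply: (sorted_leq_nth le_trans le_refl) => //.
exact: leq_ltn_trans js.
Qed.

Lemma count_sorted_le (s : seq R) i : sorted <=%R s -> (0 < i <= size s)%N ->
  (i <= count (fun x : R => (x <= nth 0 s i.-1)%R) s)%N.
Proof.
move=> ss /andP[i0 si]; rewrite -[X in count _ X](cat_take_drop i) count_cat.
rewrite (leq_trans _ (leq_addr _ _)) //.
suff : all (fun x : R => x <= nth 0 s i.-1) (take i s).
  by rewrite all_count size_takel // => /eqP ->.
apply/(all_nthP 0) => l; rewrite size_takel // => li; rewrite nth_take //.
apply: leq_nth_sorted => //; lia.
Qed.

Lemma count_sorted_lt (s : seq R) i : sorted <=%R s -> (0 < i <= size s)%N ->
  (count (fun x : R => (x < nth 0 s i.-1)%R) s <= i.-1)%N.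
Proof.
move=> ss /andP[i0 si]; rewrite -[X in count _ X](cat_take_drop i.-1) count_cat.
suff /eqP-> : count (fun x => (x < nth 0 s i.-1)%R) (drop i.-1 s) == 0.
  by rewrite addn0 (leq_trans (count_size _ _)) // size_take; case: ifP; lia.
rewrite -leqn0 leqNgt -has_count -all_predC; apply/(all_nthP 0) => l.
rewrite size_drop -[size s]/(@size R s) => li /=; rewrite nth_drop -leNgt.
by apply: leq_nth_sorted => //; lia.
Qed.

(* The two halves of the Courant-Fischer formula. *)
Lemma eig_ge (T : 'End(fspace R I)) L (i : nat) (c : R) : symmetric_op T ->
  (size L < i <= #|I|)%N ->
  (forall f, orth L f -> c * ip f f <= ip (T f) f) -> c <= eig T i.
Proof.
move=> symT /andP[Li iI] Lc; have [b [a [b_on Tb]]] := exists_eigenbasis symT.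
have sE := spectrum_eigenbasis b_on Tb.
(* At most [#|I| - i] eigenvectors have an eigenvalue above [eig T i], so fewer than [#|I|]
   conditions are imposed. A nonzero solution is a combination of the other eigenvectors, with
   Rayleigh quotient at most [eig T i]. *)
pose L' := L ++ [seq b x | x <- enum I & ~~ (a x <= eig T i)].
have [f f0] : exists2 f, f != 0 & orth L' f.
  apply: exists_orth; rewrite size_cat size_map size_filter.
  have := @count_sorted_le (spectrum T) i.
  rewrite size_spectrum // sE sort_le_sorted count_sort count_map -sE iI.
  rewrite (leq_ltn_trans _ Li) // => /(_ isT isT).
  have := count_predC (fun x => a x <= eig T i) (enum I).
  rewrite -cardE => <- /=; rewrite /eig; set u := count _ _; set v := count _ _.
  by move=> *; lia.
rewrite orth_cat => /andP[/Lc Lf /orthP bf].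
have f1 := ip_gt0 f0; rewrite -(ler_pM2r f1); apply: le_trans Lf _.
rewrite (ip_op_eigenbasis b_on Tb) (ip_eigenbasis b_on) mulr_sumr.
apply: ler_sum => x _; have [ax|ax] := boolP (a x <= eig T i).
  by rewrite ler_wpM2r ?sqr_ge0.
rewrite bf ?expr0n ?mulr0 //.
by rewrite map_f // mem_filter ax mem_enum.
Qed.

Lemma eig_le_form (T : 'End(fspace R I)) (i : nat) : symmetric_op T ->
  (0 < i <= #|I|)%N ->
  exists2 L, (size L < i)%N &
    forall f, orth L f -> eig T i * ip f f <= ip (T f) f.
Proof.
move=> symT iI; have [b [a [b_on Tb]]] := exists_eigenbasis symT.
have sE := spectrum_eigenbasis b_on Tb.
(* At most i - 1 eigenvalues lie strictly below the i-th one. *)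
exists [seq b x | x <- enum I & a x < eig T i].
  rewrite size_map size_filter.
  have := @count_sorted_lt (spectrum T) i.
  rewrite size_spectrum // sE sort_le_sorted count_sort count_map -sE iI.
  by move=> /(_ isT isT) H; case/andP: iI => i0 _; apply: leq_ltn_trans H _;
    lia.
move=> f /orthP bf; rewrite (ip_op_eigenbasis b_on Tb) (ip_eigenbasis b_on)
  mulr_sumr.
apply: ler_sum => x _; have [ax|ax] := leP (eig T i) (a x).
  by rewrite ler_wpM2r ?sqr_ge0.
rewrite bf ?expr0n ?mulr0 //.
by rewrite map_f // mem_filter ax mem_enum.
Qed.

Lemma symmetric_mul_op (d : fspace R I) : symmetric_op (mul_op d).
Proof.
move=> u v; apply: eq_bigr => x _; rewrite !lfunE /= !ffunE.
by rewrite mulrCA mulrA.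
Qed.

Lemma eig_mul_op (d : fspace R I) (j : nat) :
  eig (mul_op d) j = nth 0 (sort <=%R (codom d)) j.-1.
Proof.
rewrite /eig (@spectrum_eigenbasis _ (@delta R I) d) // => [x y|x].
  by rewrite ip_delta ffunE eq_sym.
apply/ffunP => y; rewrite !lfunE /= !ffunE.
by case: eqP => [->//|_]; rewrite mulr0 scaler0.
Qed.

End SymmetricOperators.

(** * Path inequalities *)

Section Paths.
Variable R : realType.
Implicit Types (a c h s : R) (g y : nat -> R).

(* a is at most the first Dirichlet eigenvalue of the path 0 ~ 1 ~ ... ~ k with
   boundary {0} and edge weights s, 1, ..., 1, where g l is the value at the
   vertex l + 1. *)
Definition path_ineq a s (k : nat) := forall g,
  a * \sum_(l < k) g l ^+ 2
    <= s * g 0%N ^+ 2 + \sum_(l < k.-1) (g l.+1 - g l) ^+ 2.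

Lemma path_ineq_weight a s1 s2 k : s1 <= s2 ->
  path_ineq a s1 k -> path_ineq a s2 k.
Proof.
by move=> s12 P g; apply: le_trans (P g) _; rewrite lerD2r ler_wpM2r ?sqr_ge0.
Qed.

(** Tested on 0, g 0, g 1, ..., the term with [s] vanishes and the first gap becomes an anchor of
    weight 1. *)
Lemma path_ineq_pred a s k : path_ineq a s k.+1 -> path_ineq a 1 k.
Proof.
case: k => [|k] P g; first by rewrite !big_ord0 mulr0 addr0 mul1r sqr_ge0.
have := P (fun l => if l is l'.+1 then g l' else 0).
by rewrite !big_ord_recl /= expr0n /= mulr0 !add0r subr0 mul1r.
Qed.

(** Prolonging [g] by its last value adds mass but no energy, which is enough when [a >= 0]; a
    negative [a] makes the left side nonpositive. *)
Lemma path_ineq_leq a s k k' : 0 <= s -> (k' <= k)%N ->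
  path_ineq a s k -> path_ineq a s k'.
Proof.
move=> s0; elim: k => [|k IH]; first by rewrite leqn0 => /eqP ->.
rewrite leq_eqVlt => /orP[/eqP -> //|k'k] P; apply: IH k'k _ => g.
case: k => [|k] in P *; first by rewrite !big_ord0 mulr0 addr0 mulr_ge0 //
  sqr_ge0.
have [a0|/ltW a0] := leP 0 a; last first.
  have S0 (m : nat) (F : 'I_m -> R) : 0 <= \sum_(l < m) F l ^+ 2.
    by apply: sumr_ge0 => l _; exact: sqr_ge0.
  apply: (@le_trans _ _ 0); first by rewrite mulr_le0_ge0.
  by rewrite addr_ge0 // mulr_ge0 // sqr_ge0.
have := P (fun l => if (l <= k)%N then g l else g k) => /=.
rewrite big_ord_recr [in X in _ <= X ->
  _]big_ord_recr /= ltnn leqnn subrr expr0n addr0.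
under eq_bigr => l _ do rewrite -ltnS ltn_ord.
under [in X in _ <= X -> _]eq_bigr => l _ do rewrite ltn_ord (ltnW (ltn_ord l)).
by apply: le_trans; rewrite ler_wpM2l // lerDl sqr_ge0.
Qed.

(* Picone's identity: y is a positive solution of the eigenvalue equation, and
   (g' - g)^2 >= (y' - y) (g'^2 / y' - g^2 / y) telescopes. *)
Lemma path_ineq_picone a y k : (forall l, (l < k)%N -> 0 < y l) ->
  a * y 0%N = 2 * y 0%N - y 1%N ->
  (forall l, (l.+1 < k)%N -> a * y l.+1 = 2 * y l.+1 - y l - y l.+2) ->
  (0 < k)%N -> y k.-1 <= y k -> path_ineq a 1 k.
Proof.
case: k => // k y_gt0 y0 yS _ yk g; rewrite mul1r.
(* The telescoped inequality for the first m + 1 vertices; its boundary term is nonnegative at m = k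
   because [y k.-1 <= y k]. The induction step is the nonnegativity of a weighted square in [g m]
   and [g m.+1]. *)
suff H m : (m <= k)%N ->
    a * \sum_(l < m.+1) g l ^+ 2 + (y m.+1 / y m - 1) * g m ^+ 2
      <= g 0%N ^+ 2 + \sum_(l < m) (g l.+1 - g l) ^+ 2.
  apply: le_trans (H _ (leqnn k)); rewrite lerDl mulr_ge0 ?sqr_ge0 //.
  by rewrite subr_ge0 ler_pdivlMr ?mul1r ?y_gt0.
elim: m => [|m IH] mk.
  rewrite big_ord_recl !big_ord0 !addr0 -mulrDl -[leRHS]mul1r ler_wpM2r
    ?sqr_ge0 //.
  have p0 := y_gt0 _ (ltn0Sn k).
  by rewrite -(ler_pM2r p0) mulrDl y0 mulrBl divfK ?gt_eqF //; lra.
rewrite big_ord_recr /= [in leRHS]big_ord_recr /= mulrDr.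
have := IH (ltnW mk); set S1 := \sum_(_ < _) _; set S2 := \sum_(_ < _) _.
have p1 := y_gt0 m (leqW mk); have p2 := y_gt0 m.+1 mk.
have := yS m mk; move: (g m) (g m.+1) (y m) (y m.+1) (y m.+2) p1 p2 =>
  u v p q r p0 q0 E H.
have aE : a = 2 - p / q - r / q.
  by apply: (mulIf (lt0r_neq0 q0)); rewrite E; field; rewrite gt_eqF.
have : 0 <= (q / p) * (u - p / q * v) ^+ 2 by rewrite mulr_ge0 ?sqr_ge0 //
  divr_ge0 ?ltW.
have -> : q / p * (u - p / q * v) ^+ 2 = q / p * u ^+ 2 - 2 * u * v + p / q * v
  ^+ 2.
  by field; rewrite !gt_eqF.
have : a * v ^+ 2 + (r / q - 1) * v ^+ 2 = (1 - p / q) * v ^+ 2 by rewrite aE;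
  ring.
move: H; move: (r / q) (q / p) (p / q) => x1 x2 x3; nra.
Qed.

(** Counterpart of [path_ineq_picone] for upper bounds: the solution of the eigenvalue equation on
    the free path is [(-1)^l * y l], whence the plus signs in the recurrences. *)
Lemma path_form_picone c y n g : (forall l, (l < n)%N -> 0 < y l) ->
  c * y 0%N = y 0%N + y 1%N ->
  (forall l, (l.+1 < n)%N -> c * y l.+1 = 2 * y l.+1 + y l + y l.+2) ->
  (0 < n)%N -> - y n.-1 <= y n ->
  \sum_(l < n.-1) (g l.+1 - g l) ^+ 2 <= c * \sum_(l < n) g l ^+ 2.
Proof.
case: n => // k y_gt0 y0 yS _ yk.
suff H m : (m <= k)%N ->
    \sum_(l < m) (g l.+1 - g l) ^+ 2 + (1 + y m.+1 / y m) * g m ^+ 2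
      <= c * \sum_(l < m.+1) g l ^+ 2.
  apply: le_trans (H _ (leqnn k)); rewrite lerDl mulr_ge0 ?sqr_ge0 //.
  by rewrite -lerBlDl sub0r ler_pdivlMr ?mulN1r ?y_gt0.
elim: m => [|m IH] mk.
  rewrite big_ord_recl !big_ord0 !addr0 add0r ler_wpM2r ?sqr_ge0 //.
  have p0 := y_gt0 _ (ltn0Sn k).
  by rewrite -(ler_pM2r p0) mulrDl y0 divfK ?gt_eqF // mul1r.
rewrite big_ord_recr /= [in leRHS]big_ord_recr /= mulrDr.
have := IH (ltnW mk); set S1 := \sum_(_ < _) _; set S2 := \sum_(_ < _) _.
have p1 := y_gt0 m (leqW mk); have p2 := y_gt0 m.+1 mk.
have := yS m mk; move: (g m) (g m.+1) (y m) (y m.+1) (y m.+2) p1 p2 =>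
  u v p q r p0 q0 E H.
have cE : c = 2 + p / q + r / q.
  by apply: (mulIf (lt0r_neq0 q0)); rewrite E; field; rewrite gt_eqF.
have : 0 <= (q / p) * (u + p / q * v) ^+ 2 by rewrite mulr_ge0 ?sqr_ge0 //
  divr_ge0 ?ltW.
have -> : q / p * (u + p / q * v) ^+ 2 = q / p * u ^+ 2 + 2 * u * v + p / q * v
  ^+ 2.
  by field; rewrite !gt_eqF.
have : c * v ^+ 2 - (1 + r / q) * v ^+ 2 = (1 + p / q) * v ^+ 2 by rewrite cE;
  ring.
move: H; move: (r / q) (q / p) (p / q) => x1 x2 x3; nra.
Qed.

Lemma sin_pred_succ (t u : R) : sin (u - t) + sin (u + t) = 2 * cos t * sin u.
Proof. by rewrite sinB sinD; ring. Qed.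

(** With t = pi / (2k + 1), the solution sin ((l + 1) t) vanishes at the boundary vertex, and it
    takes equal values at l = k - 1 and l = k because (k + 1) t = pi - k t. *)
Lemma path_ineq_cos k : (0 < k)%N ->
  path_ineq (2 * (1 - cos (pi / (2 * k + 1)%:R))) 1 k.
Proof.
move=> k0; set t : R := pi / _.
have tE : t * (2 * k + 1)%:R = pi by rewrite divfK // pnatr_eq0 addn1.
have t0 : 0 < t by rewrite divr_gt0 ?pi_gt0 // ltr0n addn1.
apply: (@path_ineq_picone _ (fun l => sin (l.+1%:R * t))) => //.
- move=> l lk; apply: sin_gt0_pi;
  rewrite mulr_gt0 ?ltr0n //= -tE mulrC ltr_pM2l //.
  by rewrite ltr_nat; lia.
- have := sin_pred_succ t t; rewrite subrr sin0 (_ : t + t = 2 * t);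
  last by ring.
  by rewrite mul1r; lra.
- move=> l _; have := sin_pred_succ t (l.+2%:R * t).
  rewrite (_ : _ - t = l.+1%:R * t); last by rewrite -[l.+2%:R]natr1; ring.
  by rewrite (_ : _ + t = l.+3%:R * t) -?[l.+3%:R]natr1; [lra | ring].
- rewrite prednK // (_ : k.+1%:R * t = pi - k%:R * t); last first.
    by rewrite -tE natrD natrM -natr1; ring.
  by rewrite sinB sinpi cospi mul0r sub0r mulN1r opprK.
Qed.

End Paths.

(** * The top eigenvector of a path and the weights at cut edges *)

Section CutWeights.
Variables (R : realType) (n : nat).
Hypothesis n_gt1 : (1 < n)%N.
Implicit Types z : nat.

Let h : R := pi / (2 * n)%:R.

(** The largest Laplacian eigenvalue of the path on n vertices. *)
Definition path_top : R := 2 + 2 * cos (pi / n%:R).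

(* Up to signs, the eigenvector of the top eigenvalue of the Laplacian of the
   path with vertices 0, ..., n - 1. *)
Definition cut_vec z : R := sin ((2 * z + 1)%:R * h).

(** For z > 0 this is [1 + cut_vec z.-1 / cut_vec z]: cutting an edge of conductance 1 where the
    linear interpolation between [- cut_vec z.-1] and [cut_vec z] vanishes leaves a half-edge of
    this conductance at the second end. The closed form gives 0 at z = 0 and makes subadditivity a
    trigonometric identity. *)
Definition cut_weight z : R := 2 * cos h * sin ((2 * z)%:R * h) / cut_vec z.

Let hn : h * (2 * n)%:R = pi.
Proof. by rewrite divfK // pnatr_eq0; lia. Qed.

Let h_gt0 : 0 < h.
Proof. by rewrite divr_gt0 ?pi_gt0 // ltr0n; lia. Qed.

Let sin_h_gt0 z : (0 < z < 2 * n)%N -> 0 < sin (z%:R * h).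
Proof.
move=> /andP[z0 zn]; apply: sin_gt0_pi; rewrite mulr_gt0 ?ltr0n //= -hn mulrC.
by rewrite ltr_pM2l // ltr_nat.
Qed.

Let sin_h_ge0 z : (z <= 2 * n)%N -> 0 <= sin (z%:R * h).
Proof.
move=> zn; apply: sin_ge0_pi;
  rewrite mulr_ge0 ?ler0n ?(ltW h_gt0) //= -hn mulrC.
by rewrite ler_pM2l // ler_nat.
Qed.

Let cos_h_ge0 : 0 <= cos h.
Proof.
rewrite cos_ge0_pihalf // -hn natrM.
have := h_gt0; have : (1 : R) <= n%:R by rewrite ler1n; lia.
by nra.
Qed.

Lemma path_topE : path_top = 2 + 2 * cos (2 * h).
Proof. by congr (2 + 2 * cos _); rewrite /h natrM; field; rewrite pnatr_eq0;
  lia. Qed.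

Lemma cut_vec_gt0 z : (z < n)%N -> 0 < cut_vec z.
Proof. by move=> zn; apply: sin_h_gt0; lia. Qed.

Lemma cut_vec_rec z :
  path_top * cut_vec z.+1 = 2 * cut_vec z.+1 + cut_vec z + cut_vec z.+2.
Proof.
rewrite path_topE /cut_vec;
  have := sin_pred_succ (2 * h) ((2 * z.+1 + 1)%:R * h).
have -> : (2 * z.+1 + 1)%:R * h - 2 * h = (2 * z + 1)%:R * h by ring.
have -> : (2 * z.+1 + 1)%:R * h + 2 * h = (2 * z.+2 + 1)%:R * h by ring.
by lra.
Qed.

Lemma cut_vec_rec0 : path_top * cut_vec 0 = cut_vec 0 + cut_vec 1.
Proof.
rewrite path_topE /cut_vec; have := sin_pred_succ (2 * h) ((2 * 0 + 1)%:R * h).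
have -> : (2 * 0 + 1)%:R * h - 2 * h = - ((2 * 0 + 1)%:R * h) by ring.
have -> : (2 * 0 + 1)%:R * h + 2 * h = (2 * 1 + 1)%:R * h by ring.
by rewrite sinN; lra.
Qed.

Lemma cut_vec_top : cut_vec n = - cut_vec n.-1.
Proof.
rewrite /cut_vec.
rewrite (_ : (2 * n + 1)%:R * h = h + pi); last by rewrite -hn; ring.
rewrite (_ : (2 * n.-1 + 1)%:R * h = pi - h).
  by rewrite sinDpi sinB sinpi cospi; ring.
rewrite -hn (_ : (2 * n = (2 * n.-1 + 1).+1)%N); last by lia.
by ring.
Qed.

Lemma cut_weightS z : (z.+1 < n)%N ->
  cut_weight z.+1 = 1 + cut_vec z / cut_vec z.+1.
Proof.
move=> zn; have x0 := cut_vec_gt0 zn; rewrite /cut_weight.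
rewrite -[in RHS](divff (lt0r_neq0 x0)) -[in RHS]mulrDl; congr (_ / _).
rewrite -sin_pred_succ addrC /cut_vec.
by congr (sin _ + sin _); ring.
Qed.

Lemma cut_weight0 : cut_weight 0 = 0.
Proof. by rewrite /cut_weight muln0 mul0r sin0 mulr0 mul0r. Qed.

(** The eigenvalue equation divided by [cut_vec z]: the half-edges on the two sides of a vertex have
    total conductance [path_top]. *)
Lemma cut_weight_balance z : (z < n)%N ->
  cut_weight z + (1 + cut_vec z.+1 / cut_vec z) = path_top.
Proof.
move=> zn; have x0 := lt0r_neq0 (cut_vec_gt0 zn); apply: (mulIf x0).
case: z zn x0 => [|z] zn x0.
  by rewrite cut_weight0 add0r mulrDl divfK // cut_vec_rec0 mul1r.
by rewrite cut_weightS // cut_vec_rec !mulrDl !divfK //; ring.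
Qed.

Lemma cut_weight_top : cut_weight n.-1 = path_top.
Proof.
rewrite -(@cut_weight_balance n.-1); last by lia.
rewrite (ltn_predK n_gt1) cut_vec_top mulNr divff ?subrr ?addr0 //.
by rewrite gt_eqF // cut_vec_gt0; lia.
Qed.

Lemma cut_weight_ge1 z : (0 < z < n)%N -> 1 <= cut_weight z.
Proof.
case: z => // z zn; rewrite cut_weightS // lerDl divr_ge0 // ltW // cut_vec_gt0
  //.
by lia.
Qed.

Lemma cut_weight_ge0 z : (z < n)%N -> 0 <= cut_weight z.
Proof.
case: z => [|z] zn; first by rewrite cut_weight0.
by apply: le_trans ler01 _; apply: cut_weight_ge1.
Qed.

(** The left side is the numerator of F s + F t - F (s + t) for F s = sin s / sin (s + u); it
    factors, which shows its sign. *)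
Lemma sin_ratio_subadd (s t u : R) :
  sin s * sin (t + u) * sin (s + t + u) + sin t * sin (s + u) * sin (s + t + u)
    - sin (s + t) * sin (s + u) * sin (t + u)
  = sin s * sin t * sin (s + t + u + u).
Proof.
have H1 : sin s * sin (s + t + u) - sin (s + t) * sin (s + u) = - (sin u * sin
  t).
  have := cos2Dsin2 s; rewrite !sinD cosD => E.
  transitivity (- (sin u * sin t) * (cos s ^+ 2 + sin s ^+ 2)); first by ring.
  by rewrite E mulr1.
have H2 : sin (s + u) * sin (s + t + u) - sin u * sin (t + u)
    = sin s * sin (s + t + u + u).
  have := cos2Dsin2 s; rewrite -!addrA !(sinD, cosD) => E.
  rewrite -[LHS]subr0 -[RHS]subr0; apply/eqP; rewrite -subr_eq0; apply/eqP.
  set w := (X in X = 0).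
  have -> : w = sin u * (sin t * cos u + cos t * sin u) * (cos s ^+ 2 + sin s
    ^+ 2 - 1).
    by rewrite /w; ring.
  by rewrite E subrr mulr0.
transitivity (sin (t + u) * (sin s * sin (s + t + u) - sin (s + t) * sin (s +
  u))
  + sin t * sin (s + u) * sin (s + t + u)); first by ring.
rewrite H1; transitivity (sin t * (sin (s + u) * sin (s + t + u) - sin u * sin
  (t + u))).
  by ring.
by rewrite H2; ring.
Qed.

(** Apply [sin_ratio_subadd] with s = 2 z1 h, t = 2 z2 h and u = h; the last factor is sin (2 (z1 +
    z2 + 1) h), whose angle is at most pi. This is what lets two leftover pieces be merged. *)
Lemma cut_weight_subadd z1 z2 : (z1 + z2 < n)%N ->
  cut_weight (z1 + z2) <= cut_weight z1 + cut_weight z2.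
Proof.
move=> zn.
have x1 : 0 < cut_vec z1 by apply: cut_vec_gt0; lia.
have x2 : 0 < cut_vec z2 by apply: cut_vec_gt0; lia.
have x3 := cut_vec_gt0 zn.
rewrite -subr_ge0 /cut_weight.
have E z : cut_vec z = sin ((2 * z)%:R * h + h) by congr sin; ring.
have E3 : (2 * (z1 + z2))%:R * h = (2 * z1)%:R * h + (2 * z2)%:R * h.
  by ring.
have := sin_ratio_subadd ((2 * z1)%:R * h) ((2 * z2)%:R * h) h.
rewrite -E3 -!E.
have s1 : 0 <= sin ((2 * z1)%:R * h) by apply: sin_h_ge0; lia.
have s2 : 0 <= sin ((2 * z2)%:R * h) by apply: sin_h_ge0; lia.
have s3 : 0 <= sin ((2 * (z1 + z2))%:R * h + h + h).
  rewrite (_ : _ + h + h = (2 * (z1 + z2).+1)%:R * h); last first.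
    by ring.
  by apply: sin_h_ge0; lia.
have := mulr_ge0 (mulr_ge0 s1 s2) s3 => H /(congr1 (fun x => 0 <= x));
  rewrite H.
move: (sin ((2 * z1)%:R * h)) (sin ((2 * z2)%:R * h)) (sin ((2 * (z1 + z2))%:R
  * h)).
move: (cut_vec z1) (cut_vec z2) (cut_vec (z1 + z2)) x1 x2 x3.
move=> p q r p0 q0 r0 s t u /idP {}H.
rewrite (_ : _ - _ = 2 * cos h * (s * q * r + t * p * r - u * p * q) / (p * q *
  r)).
  by rewrite divr_ge0 ?mulr_ge0 // ltW // !mulr_gt0.
by field; rewrite !gt_eqF.
Qed.

Lemma path_form_le_top (g : nat -> R) :
  \sum_(l < n.-1) (g l.+1 - g l) ^+ 2 <= path_top * \sum_(l < n) g l ^+ 2.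
Proof.
apply: (@path_form_picone _ _ cut_vec) => //.
- exact: cut_vec_gt0.
- exact: cut_vec_rec0.
- by move=> l _; exact: cut_vec_rec.
- by lia.
- by rewrite cut_vec_top.
Qed.

End CutWeights.

(** * Connected sets and energy *)

Section InducedConnectivity.
Variables (I : finType) (e : rel I).
Hypothesis e_sym : symmetric e.
Implicit Types (S : {set I}) (r x y : I).

Definition within S : rel I := fun x y => [&& x \in S, y \in S & e x y].

Definition conn S := {in S &, forall x y, connect (within S) x y}.

Lemma within_sym S : connect_sym (within S).
Proof.
apply: sym_connect_sym => x y.
by rewrite /within e_sym andbCA.
Qed.

Lemma connect_cross (q : rel I) (b : pred I) x y : connect q x y ->
  b x -> ~~ b y -> exists u v, [/\ q u v, b u & ~~ b v].
Proof.
move=> /connectP[p]; elim: p x => [|z p IH] x /= => [_ -> -> //|].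
move=> /andP[xz zp] yE bx nby; have [bz|nbz] := boolP (b z).
  exact: IH zp yE bz nby.
by exists x, z.
Qed.

Lemma connect_within S x y : x \in S -> connect (within S) x y -> y \in S.
Proof.
move=> xS xy; apply: contraT => yS.
by have [u [v [/and3P[_ vS _] _ /negP]]] := connect_cross xy xS yS.
Qed.

Lemma conn_root S r : (forall x, x \in S -> connect (within S) r x) -> conn S.
Proof.
move=> rS x y xS yS; apply: connect_trans (rS y yS).
by rewrite within_sym rS.
Qed.

Lemma conn1 r : conn [set r].
Proof. by move=> x y /set1P -> /set1P ->. Qed.

Lemma connect_within_mono S S' x y : S \subset S' ->
  connect (within S) x y -> connect (within S') x y.
Proof.
move=> /subsetP SS; apply: connect_sub => u v /and3P[uS vS uv].
by apply: connect1; rewrite /within !SS.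
Qed.

Lemma connU S1 S2 r1 r2 : conn S1 -> conn S2 -> r1 \in S1 -> r2 \in S2 ->
  e r1 r2 -> conn (S1 :|: S2).
Proof.
move=> c1 c2 r1S r2S r12; apply: (@conn_root _ r1) => x /setUP[xS|xS].
  exact: connect_within_mono (subsetUl _ _) (c1 _ _ r1S xS).
apply: connect_trans (connect_within_mono (subsetUr _ _) (c2 _ _ r2S xS)).
by apply: connect1; rewrite /within !inE r1S r2S orbT.
Qed.

(** Cut off one branch at [r]: [S2] is the component of a neighbour [r'] of [r] in [S :\ r], and
    [S1] is the rest of [S]. *)
Lemma conn_split S r : conn S -> r \in S -> S != [set r] ->
  exists S1 S2 r', [/\ S = S1 :|: S2, [disjoint S1 & S2], r \in S1, r' \in S2 &
    [/\ e r r', conn S1 & conn S2]].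
Proof.
move=> cS rS Sr.
have [v vS vr] : exists2 v, v \in S & v != r.
  have : S :\ r != set0.
    apply: contraNneq Sr => S0; rewrite eqEsubset sub1set rS andbT.
    by rewrite -setD_eq0 S0.
  by move=> /set0Pn[v]; rewrite !inE => /andP[vr vS]; exists v.
have [x0 [r' [/and3P[_ r'S rr'] /eqP x0r /= r'r]]] :=
  @connect_cross _ (pred1 r) _ _ (cS _ _ rS vS) (eqxx r) vr.
rewrite {}x0r in rr'.
pose S2 := [set x | connect (within (S :\ r)) r' x].
have r'Sr : r' \in S :\ r by rewrite !inE r'r.
have S2S x : x \in S2 -> x \in S :\ r.
  by rewrite inE; apply: connect_within.
have S2step x y : x \in S2 -> y \in S :\ r -> e x y -> y \in S2.
  move=> xS2 yS xy; have xS := S2S _ xS2; move: xS2;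
    rewrite !inE => /connect_trans; apply.
  by apply: connect1; rewrite /within xS yS.
have r'S2 : r' \in S2 by rewrite inE connect0.
exists (S :\: S2), S2, r'; split=> //.
- apply/setP => x; rewrite in_setU in_setD; have [/S2S|] := boolP (x \in S2);
  last by rewrite orbF.
  by rewrite !inE => /andP[_ ->].
- by rewrite -setI_eq0 setDE -setIA (setIC (~: S2)) setICr setI0.
- by rewrite in_setD rS andbT; apply/negP => /S2S; rewrite !inE eqxx.
split=> //.
  apply: (@conn_root _ r) => y yS1; apply: contraT => nby.
  (* An edge of [S] leaving [S2] can only end at [r], so no edge of [S] leaves the set [b]. *)
  pose b z := (z \in S2) || connect (within (S :\: S2)) r z.
  have rS1 : r \in S :\: S2.
    by rewrite in_setD rS andbT; apply/negP => /S2S; rewrite !inE eqxx.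
  move: (yS1); rewrite in_setD => /andP[yS2 yS].
  have br : b r by rewrite /b connect0 orbT.
  have {}nby : ~~ b y by rewrite /b negb_or yS2.
  have [u [w [/and3P[uS wS uw] bu]]] := connect_cross (cS _ _ rS yS) br nby.
  rewrite /b negb_or => /andP[wS2 /negP[]]; case/orP: bu => [uS2|ru].
    have [->|wr] := eqVneq w r; first exact: connect0.
    by case/negP: wS2; apply: (S2step u w) => //; rewrite in_setD1 wr.
  apply: (connect_trans ru (connect1 _)).
  rewrite /within (connect_within rS1 ru) uw.
  by rewrite in_setD wS2 wS.
apply: (@conn_root _ r') => y yS2; apply: contraT => nby.
have := yS2; rewrite inE => r'y.
have [u [w [/and3P[uS wS uw] bu /negP[]]]] :=
  @connect_cross _ (connect (within S2) r') _ _ r'y (connect0 _ _) nby.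
apply: (connect_trans bu (connect1 _)); have uS2 := connect_within r'S2 bu.
by rewrite /within uS2 (S2step u w) // uw.
Qed.

End InducedConnectivity.

(** * Energy and mass of functions on vertex sets *)

Section EnergyForm.
Variables (R : realType) (I : finType) (e : rel I).
Hypothesis e_sym : symmetric e.
Implicit Types (S A : {set I}) (r x y : I) (f : I -> R).

Definition cross S A f := \sum_(x in S) \sum_(y in A) (e x y)%:R * (f x - f y)
  ^+ 2.

(** The division by 2 makes up for every edge occurring as two ordered pairs. *)
Definition form S f := cross S S f / 2.

Definition mass S f := \sum_(x in S) f x ^+ 2.

Lemma sum_setU (S1 S2 : {set I}) (F : I -> R) : [disjoint S1 & S2] ->
  \sum_(x in S1 :|: S2) F x = \sum_(x in S1) F x + \sum_(x in S2) F x.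
Proof.
move=> dS; rewrite (big_setID S1) setUK setDUl setDv set0U; congr (_ + _).
by apply: eq_bigl => x; rewrite (setDidPl _) // disjoint_sym.
Qed.

Lemma sum_subset (S1 S2 : {set I}) (F : I -> R) : S1 \subset S2 ->
  (forall x, 0 <= F x) -> \sum_(x in S1) F x <= \sum_(x in S2) F x.
Proof.
move=> S12 F0; rewrite [leRHS](big_setID S1) (setIidPr S12) lerDl.
by rewrite sumr_ge0.
Qed.

Lemma cross_term_ge0 f x y : 0 <= (e x y)%:R * (f x - f y) ^+ 2.
Proof. by rewrite mulr_ge0 ?sqr_ge0. Qed.

Lemma crossUl S1 S2 A f : [disjoint S1 & S2] ->
  cross (S1 :|: S2) A f = cross S1 A f + cross S2 A f.
Proof. exact: sum_setU. Qed.

Lemma crossC S A f : cross S A f = cross A S f.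
Proof.
rewrite /cross exchange_big; apply: eq_bigr => x _; apply: eq_bigr => y _.
by rewrite e_sym -sqrrN opprB.
Qed.

Lemma cross_mono S S' A A' f : S \subset S' -> A \subset A' ->
  cross S A f <= cross S' A' f.
Proof.
move=> SS AA; apply: (@le_trans _ _ (cross S' A f)).
  by apply: sum_subset => // x; apply: sumr_ge0 => y _; apply: cross_term_ge0.
apply: ler_sum => x _; apply: sum_subset => // y; exact: cross_term_ge0.
Qed.

Lemma cross_edge S A f x y : x \in S -> y \in A -> e x y ->
  (f x - f y) ^+ 2 <= cross S A f.
Proof.
move=> xS yA xy; apply: le_trans (@cross_mono [set x] _ [set y] _ _ _ _).
- by rewrite /cross !big_set1 xy mul1r.
- by rewrite sub1set.
- by rewrite sub1set.
Qed.

Lemma formU S1 S2 f : [disjoint S1 & S2] ->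
  form (S1 :|: S2) f = form S1 f + form S2 f + cross S1 S2 f.
Proof.
move=> dS; rewrite /form crossUl // !(crossC _ (_ :|: _)) !crossUl //.
by rewrite (crossC S2 S1); field.
Qed.

Lemma form_ge0 S f : 0 <= form S f.
Proof.
rewrite divr_ge0 //; apply: sumr_ge0 => x _; apply: sumr_ge0 => y _.
exact: cross_term_ge0.
Qed.

Lemma massU S1 S2 f : [disjoint S1 & S2] ->
  mass (S1 :|: S2) f = mass S1 f + mass S2 f.
Proof. exact: sum_setU. Qed.

(** The gaps are nonnegative, so the sum of their squares is at most the square of their sum, which
    telescopes. Truncating i and j at m allows induction on m. *)
Lemma sum_crossed_gaps (g : nat -> R) i j m :
  {in [pred l | (l <= m)%N] &, {homo g : l l' / (l <= l')%N >-> l <= l'}} ->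
  \sum_(l < m) ((i <= l) != (j <= l))%N%:R * (g l.+1 - g l) ^+ 2
    <= (g (minn i m) - g (minn j m)) ^+ 2.
Proof.
wlog ij : i j / (i <= j)%N.
  move=> H; have [/H|/ltnW/H] := leqP i j; first exact.
  rewrite -sqrrN opprB => H' /H'; apply: le_trans.
  by apply: ler_sum => l _; rewrite eq_sym.
elim: m => [|m IH] g_homo; first by rewrite big_ord0 sqr_ge0.
rewrite big_ord_recr /=.
have {}IH : \sum_(l < m) ((i <= l)%N != (j <= l)%N)%:R * (g l.+1 - g l) ^+ 2 <=
    (g (minn i m) - g (minn j m)) ^+ 2.
  by apply: IH => l l' lm lm'; apply: g_homo; rewrite inE leqW.
have [jm|mj] := leqP j m.
  rewrite (leq_trans ij jm) eqxx mul0r addr0.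
  rewrite (minn_idPl (leqW jm)) (minn_idPl (leq_trans ij (leqW jm))).
  by rewrite (minn_idPl jm) (minn_idPl (leq_trans ij jm)) in IH.
rewrite (minn_idPr (ltnW mj)) in IH; rewrite (minn_idPr mj).
have [im|mi] := leqP i m; last first.
  rewrite eqxx mul0r addr0 (minn_idPr mi) subrr expr0n; apply: le_trans IH _.
  by rewrite (minn_idPr (ltnW mi)) subrr expr0n.
rewrite (minn_idPl im) in IH; rewrite (minn_idPl (leqW im)) mul1r.
have g1 : g i <= g m by apply: g_homo; rewrite ?inE ?leqW.
have g2 : g m <= g m.+1 by apply: g_homo; rewrite ?inE.
apply: le_trans (lerD IH (lexx _)) _; nra.
Qed.

Lemma sqr_dist_norm (u v : R) : (`|u| - `|v|) ^+ 2 <= (u - v) ^+ 2.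
Proof.
rewrite -[leLHS]real_normK ?num_real // -[leRHS]real_normK ?num_real //.
by rewrite ler_sqr ?nnegrE // ler_dist_dist.
Qed.

(* Listing the values |f x|, x in S, in increasing order only decreases the
   energy: every gap between consecutive values is crossed by an edge. *)
Lemma form_anchor a s k S f y0 : 0 <= s -> path_ineq a s k -> conn e S ->
  (#|S| <= k)%N -> y0 \in S -> a * mass S f <= form S f + s * f y0 ^+ 2.
Proof.
move=> s0 P cS Sk y0S; pose q := sort (relpre (fun x => `|f x|) <=%R) (enum S).
have qS x : (x \in q) = (x \in S) by rewrite mem_sort mem_enum.
have sq : size q = #|S| by rewrite size_sort -cardE.
have uq : uniq q by rewrite sort_uniq enum_uniq.
have q_sorted : sorted (relpre (fun x => `|f x|) <=%R) q.
  by apply: sort_sorted => x y; exact: le_total.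
pose g l := `|f (nth y0 q l)|.
pose p := #|S|.-1.
have pS : p.+1 = #|S| by rewrite prednK //; apply/card_gt0P; exists y0.
have g_homo : {in [pred l | (l <= p)%N] &,
  {homo g : l l' / (l <= l')%N >-> l <= l'}}.
  move=> l l'; rewrite !inE => lp lp' ll'; rewrite /g.
  have tr : transitive (relpre (fun x => `|f x|) <=%R) by move=> x y z;
    exact: le_trans.
  have rf : reflexive (relpre (fun x => `|f x|) <=%R) by move=> x; exact: lexx.
  by apply: (sorted_leq_nth tr rf y0 q_sorted) => //; rewrite inE sq -pS.
pose idx x := index x q.
have gidx x : x \in S -> g (idx x) = `|f x| by move=> xS;
  rewrite /g nth_index ?qS.
have idxp x : x \in S -> (idx x <= p)%N by move=> xS;
  rewrite -ltnS pS -sq index_mem qS.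
have massE : mass S f = \sum_(l < #|S|) g l ^+ 2.
  rewrite /mass -sq -(big_mkord xpredT (fun l => g l ^+ 2)).
  rewrite -(big_nth y0 xpredT (fun x => `|f x| ^+ 2)) /=.
  have Pq : perm_eq q (enum S) by rewrite /q perm_sort.
  rewrite (perm_big _ Pq) /=.
  by rewrite big_enum; apply: eq_bigr => x _; rewrite real_normK ?num_real.
have gaps : \sum_(l < p) (g l.+1 - g l) ^+ 2 <= form S f.
  (* [F l x y] charges gap l to an edge that crosses it. Over all l an edge is charged at most its
     energy, by [sum_crossed_gaps]; some edge crosses each gap, and its two orientations absorb the
     division by 2 in [form]. *)
  pose F l x y := (e x y)%:R * (((idx x <= l)%N != (idx y <= l)%N)%:R
    * (g l.+1 - g l) ^+ 2).
  have F0 l x y : 0 <= F l x y by do 2!apply: mulr_ge0 => //; exact: sqr_ge0.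
  rewrite ler_pdivlMr //.
  apply: (@le_trans _ _ (\sum_(x in S) \sum_(y in S) \sum_(l < p) F l x y));
    last first.
    apply: ler_sum => x xS; apply: ler_sum => y yS.
    rewrite -mulr_sumr ler_wpM2l // (le_trans (sum_crossed_gaps _ _ g_homo)) //.
    by rewrite !(minn_idPl (idxp _ _)) // !gidx // sqr_dist_norm.
  rewrite [leRHS](eq_bigr (fun x => \sum_(l < p) \sum_(y in S) F l x y));
    last first.
    by move=> x _; rewrite exchange_big.
  rewrite exchange_big mulr_suml /=; apply: ler_sum => l _.
  pose b := [pred x | (idx x <= l)%N].
  have nthS i : (i <= p)%N -> nth y0 q i \in S.
    by move=> ip; rewrite -qS mem_nth // sq -pS.
  have idx_nth i : (i <= p)%N -> idx (nth y0 q i) = i.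
    by move=> ip; rewrite /idx index_uniq // sq -pS.
  have lp : (l <= p)%N by rewrite ltnW.
  have bl : b (nth y0 q l) by rewrite /= idx_nth.
  have nbl : ~~ b (nth y0 q l.+1) by rewrite /= idx_nth // ltnn.
  have [u [v [/and3P[uS vS uv] bu bv]]] :=
    connect_cross (cS _ _ (nthS l lp) (nthS l.+1 (ltn_ord l))) bl nbl.
  have vDu : u \notin [set v] by rewrite inE; apply: contraNneq bv => <-.
  have uvS : [set u; v] \subset S by apply/subsetP => x /set2P[] ->.
  apply: (@le_trans _ _ (\sum_(x in [set u; v]) \sum_(y in [set u;
    v]) F l x y)).
    rewrite !big_setU1 //= !big_set1 !big_setU1 //= !big_set1.
    rewrite /F (e_sym v u) uv; move: bu bv; rewrite /= => -> /negPf ->.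
    by rewrite !eqxx /= !mul0r !mulr0 add0r addr0 !mul1r mulr_natr mulr2n.
  apply: (@le_trans _ _ (\sum_(x in [set u; v]) \sum_(y in S) F l x y)).
    by apply: ler_sum => x _; apply: sum_subset.
  by apply: sum_subset => // x; apply: sumr_ge0.
(* [g 0] is the least value of |f| on [S], so an anchor at any [y0] costs at least as much. *)
rewrite massE; apply: le_trans (path_ineq_leq s0 Sk P g) _.
rewrite addrC lerD // ler_wpM2l // -(real_normK (num_real (f y0))).
by rewrite ler_sqr ?nnegrE ?normr_ge0 // -gidx // g_homo // inE idxp.
Qed.

End EnergyForm.

(** * Cutting a connected graph *)

Section Cutting.
Variables (R : realType) (I : finType) (e : rel I) (a : R).
Hypothesis e_sym : symmetric e.
Implicit Types (S P : {set I}) (r x y : I) (f : fspace R I).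
Implicit Types (L : seq (fspace R I)) (w : R) (K d p : nat).

Local Notation form := (form e).
Local Notation conn := (conn e).

(* On the functions orthogonal to L, everything in S outside of the connected
   set P, which contains the root r, has been dealt with; w records how strongly
   P is attached to zeros of f. *)
Definition residual S r P L w := [/\ r \in P, P \subset S, conn P &
  forall f, orth L f -> exists2 y, y \in P &
    a * (mass S f - mass P f) + form P f + w * (f y : R) ^+ 2 <= form S f].

(** The square of [f r] is the energy of an additional unit edge from [r] to a zero of [f]. *)
Definition grounded S r L := forall f, orth L f ->
  a * mass S f <= form S f + (f r : R) ^+ 2.

Definition closed_cut S r L := forall f, orth L f ->
  f r = 0 /\ a * mass S f <= form S f.

Lemma residual_self S r : conn S -> r \in S -> residual S r S [::] 0.
Proof.
move=> cS rS; split=> // f _; exists r => //.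
by rewrite subrr mulr0 mul0r add0r addr0.
Qed.

Lemma residual_weight S r P L w w' : w' <= w ->
  residual S r P L w -> residual S r P L w'.
Proof.
move=> ww [rP PS cP H]; split=> // f /H[y yP yH]; exists y => //.
by apply: le_trans yH; rewrite lerD2l ler_wpM2r ?sqr_ge0.
Qed.

Lemma weight_min (w w1 w2 u v : R) : 0 <= w1 -> 0 <= w2 -> w <= w1 + w2 ->
  u ^+ 2 <= v ^+ 2 -> w * u ^+ 2 <= w1 * u ^+ 2 + w2 * v ^+ 2.
Proof.
move=> w10 w20 ww uv; apply: (@le_trans _ _ ((w1 + w2) * u ^+ 2)).
  by rewrite ler_wpM2r ?sqr_ge0.
by rewrite mulrDl lerD2l ler_wpM2l.
Qed.

(** Both weights are moved to whichever of [y1], [y2] has the smaller |f|. This vertex depends on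
    [f], and so does [y] in [residual]. *)
Lemma weight_min_ex (f : fspace R I) (P : {set I}) (w w1 w2 : R) y1 y2 :
  0 <= w1 -> 0 <= w2 -> w <= w1 + w2 -> y1 \in P -> y2 \in P ->
  exists2 y, y \in P & w * (f y : R) ^+ 2 <= w1 * (f y1 : R) ^+ 2 + w2 * (f y2
    : R) ^+ 2.
Proof.
move=> w10 w20 ww y1P y2P;
  have [uv|vu] := leP ((f y1 : R) ^+ 2) ((f y2 : R) ^+ 2).
  by exists y1 => //; exact: weight_min.
by exists y2 => //; rewrite addrC weight_min ?(ltW vu) // addrC.
Qed.

Section Combine.
Variables (S1 S2 : {set I}) (r1 r2 : I).
Hypotheses (dS : [disjoint S1 & S2]) (r12 : e r1 r2) (r2S : r2 \in S2).

(** The edge [r1 r2] joins the leftovers into one connected piece, and the energy between [S1] and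
    [S2] covers that between [P1] and [P2]. *)
Lemma residualU P1 P2 L1 L2 w1 w2 w : 0 <= w1 -> 0 <= w2 -> w <= w1 + w2 ->
  residual S1 r1 P1 L1 w1 -> residual S2 r2 P2 L2 w2 ->
  residual (S1 :|: S2) r1 (P1 :|: P2) (L1 ++ L2) w.
Proof.
move=> w10 w20 ww [rP1 PS1 cP1 H1] [rP2 PS2 cP2 H2].
have dP : [disjoint P1 & P2] by apply: disjointWl PS1 (disjointWr PS2 dS).
split; [by rewrite in_setU rP1 | exact: setUSS | exact: connU cP1 cP2 rP1 rP2
  r12 |].
move=> f; rewrite orth_cat => /andP[/H1[y1 y1P E1] /H2[y2 y2P E2]].
have y1P' : y1 \in P1 :|: P2 by rewrite in_setU y1P.
have y2P' : y2 \in P1 :|: P2 by rewrite in_setU y2P orbT.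
have [y yP Ey] := weight_min_ex f w10 w20 ww y1P' y2P'; exists y => //.
rewrite !massU // !formU //.
have := cross_mono e f PS1 PS2; move: E1 E2 Ey.
move: (mass S1 f) (mass S2 f) (mass P1 f) (mass P2 f) => m1 m2 m3 m4.
rewrite (_ : a * (m1 + m2 - (m3 + m4)) = a * (m1 - m3) + a * (m2 - m4));
  last by ring.
lra.
Qed.

(** The edge [r1 r2] settles all of [S2] and still leaves weight [v] at [r1], to be added to the
    attachment of [P1]. *)
Lemma residual_absorb P1 L1 L2 w1 v w : r1 \in S1 -> 0 <= w1 -> 0 <= v ->
  w <= w1 + v ->
  residual S1 r1 P1 L1 w1 ->
  (forall f, orth L2 f -> a * mass S2 f + v * (f r1 : R) ^+ 2
     <= form S2 f + ((f r1 : R) - (f r2 : R)) ^+ 2) ->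
  residual (S1 :|: S2) r1 P1 (L1 ++ L2) w.
Proof.
move=> r1S w10 v0 ww [rP1 PS1 cP1 H1] H2.
split=> //; first by rewrite (subset_trans PS1) ?subsetUl.
move=> f; rewrite orth_cat => /andP[/H1[y1 y1P E1] /H2 E2].
have [y yP Ey] := weight_min_ex f w10 v0 ww y1P rP1; exists y => //.
rewrite massU // formU //.
have := cross_edge f r1S r2S r12; move: E1 E2 Ey.
move: (mass S1 f) (mass S2 f) (mass P1 f) => m1 m2 m3.
rewrite (_ : a * (m1 + m2 - m3) = a * (m1 - m3) + a * m2); last by ring.
lra.
Qed.

(** As [f r1 = 0], the edge [r1 r2] is the unit edge to a zero that [S2] needs. *)
Lemma closed_cutU L1 L2 : r1 \in S1 -> closed_cut S1 r1 L1 ->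
  grounded S2 r2 L2 ->
  closed_cut (S1 :|: S2) r1 (L1 ++ L2).
Proof.
move=> r1S H1 H2 f; rewrite orth_cat => /andP[/H1[f0 E1] /H2 E2]; split=> //.
rewrite massU // formU //; have := cross_edge f r1S r2S r12.
by rewrite f0 sub0r sqrrN mulrDr; move: E1 E2; lra.
Qed.

End Combine.

Lemma closed_delta S r L : grounded S r L -> closed_cut S r (delta R r :: L).
Proof.
move=> H f /= /andP[]; rewrite ip_delta => /eqP f0 /H; rewrite f0 expr0n addr0.
by [].
Qed.

Lemma residual_grounded K S r P L w : path_ineq a 1 K -> 0 <= w ->
  (#|P| <= K)%N ->
  residual S r P L w -> grounded S r L.
Proof.
move=> aK w0 PK [rP PS cP H] f /H[y yP E].
have := form_anchor e_sym f ler01 aK cP PK rP; rewrite mul1r.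
by move: E; have := mulr_ge0 w0 (sqr_ge0 (f y : R)); rewrite mulrBr; lra.
Qed.

(** Each condition in [L] is paid for by [K] vertices of [S], with [d] vertices to spare. Either [f]
    vanishes at the root, or a leftover [P] of [p < K] vertices remains, attached with weight 1 once
    a condition has been imposed (the weight is a boolean read as 0 or 1). *)
Variant weak_cut K S r d p : Prop :=
| WeakClosed L of closed_cut S r L & (0 < size L)%N & p = 0%N
    & (K * size L + d <= #|S|)%N
| WeakResidual L P of residual S r P L (0 < size L)%N%:R & (L = [::] -> P = S)
    & p = #|P| & (#|P| < K)%N & (K * size L + #|P| + d <= #|S|)%N.

Section WeakCut.
Variables (K : nat).
Hypotheses (K_gt0 : (0 < K)%N) (aK : path_ineq a 1 K.-1).

Lemma weak_cut_grounded S r d p : weak_cut K S r d p ->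
  exists2 L, grounded S r L & (K * size L + p + d <= #|S|)%N.
Proof.
move=> [L H _ -> sL|L P H _ -> PK sL]; exists L; rewrite ?addn0 //.
  by move=> f /H[-> E]; rewrite expr0n addr0.
by apply: residual_grounded aK _ _ H; rewrite ?ler0n // -ltnS prednK.
Qed.

(** If the leftovers have at least [K] vertices together, these pay for the new condition
    [f r1 = 0]. Otherwise a closed side turns the edge [r1 r2] into an edge to a zero, and two open
    sides are merged. *)
Lemma weak_cutU S1 S2 r1 r2 d1 d2 p1 p2 :
  [disjoint S1 & S2] -> e r1 r2 -> r1 \in S1 -> r2 \in S2 ->
  weak_cut K S1 r1 d1 p1 -> weak_cut K S2 r2 d2 p2 ->
  exists p, weak_cut K (S1 :|: S2) r1 (d1 + d2) p.
Proof.
move=> dS r12 r1S r2S W1 W2.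
have cS : #|S1 :|: S2| = (#|S1| + #|S2|)%N.
  by apply/eqP; rewrite (leq_card_setU S1 S2).2.
have [L1 G1 s1] := weak_cut_grounded W1;
  have [L2 G2 s2] := weak_cut_grounded W2.
have [Kp|pK] := leqP K (p1 + p2).
  exists 0%N; apply: (@WeakClosed _ _ _ _ _ ((delta R r1 :: L1) ++ L2)) => //.
    exact: (closed_cutU dS r12 r2S r1S (closed_delta G1) G2).
  by rewrite size_cat /= cS; nia.
case: W1 pK => [L H L0 -> sL|L P H LS -> PK sL] pK.
  exists 0%N; apply: (@WeakClosed _ _ _ _ _ (L ++ L2)) => //.
  - exact: (closed_cutU dS r12 r2S r1S H G2).
  - by rewrite size_cat addn_gt0 L0.
  - by rewrite size_cat cS; nia.
case: W2 pK => [L' H' L0' -> sL'|L' P' H' LS' -> PK' sL'] pK.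
  exists #|P|; apply: (@WeakResidual _ _ _ _ _ (L ++ L') P) => //.
  - apply: (residual_absorb dS r12 r2S r1S _ ler01 _ H); rewrite ?ler0n //.
      by rewrite size_cat addn_gt0 L0' orbT lerDr ler0n.
    by move=> f /H'[-> E]; rewrite subr0 mul1r lerD2r.
  - by move=> /(congr1 size) /eqP;
    rewrite size_cat addn_eq0 (gtn_eqF L0') andbF.
  - by rewrite size_cat cS; nia.
have dP : #|P :|: P'| = (#|P| + #|P'|)%N.
  have [_ PS _ _] := H; have [_ PS' _ _] := H'.
  have := disjointWl PS (disjointWr PS' dS).
  by move=> dP; apply/eqP; rewrite (leq_card_setU P P').2.
exists (#|P :|: P'|); apply: (@WeakResidual _ _ _ _ _ (L ++ L') (P :|: P')) =>
  //.
- apply: (residualU dS r12 _ _ _ H H');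
  rewrite ?ler0n // size_cat addn_gt0 -natrD ler_nat.
  by case: (0 < size L)%N; case: (0 < size L')%N.
- by case: (L) LS => // LS; case: (L') LS' => // LS' _; rewrite LS ?LS'.
- by rewrite dP.
- by rewrite dP size_cat cS; nia.
Qed.

End WeakCut.

Lemma conn_ind (Q : {set I} -> I -> Prop) : (forall r, Q [set r] r) ->
  (forall S1 S2 r1 r2, [disjoint S1 & S2] -> e r1 r2 -> r1 \in S1 ->
    r2 \in S2 ->
     Q S1 r1 -> Q S2 r2 -> Q (S1 :|: S2) r1) ->
  forall S r, conn S -> r \in S -> Q S r.
Proof.
move=> Q1 QU S; have [m] := ubnP #|S|; elim: m S => // m IH S Sm r cS rS.
have [->|Sr] := eqVneq S [set r]; first exact: Q1.
have [S1 [S2 [r' [SE dS rS1 rS2 [rr' c1 c2]]]]] := conn_split e_sym cS rS Sr.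
have cE : #|S| = (#|S1| + #|S2|)%N.
  by apply/eqP; rewrite SE (leq_card_setU S1 S2).2.
have S1p : (0 < #|S1|)%N by apply/card_gt0P; exists r.
have S2p : (0 < #|S2|)%N by apply/card_gt0P; exists r'.
have Q1' : Q S1 r by apply: IH c1 rS1; lia.
have Q2' : Q S2 r' by apply: IH c2 rS2; lia.
by rewrite SE; exact: QU Q1' Q2'.
Qed.

Lemma mass1 r f : mass [set r] f = (f r : R) ^+ 2.
Proof. by rewrite /mass big_set1. Qed.

Lemma weak_cut1 K r : (0 < K)%N -> exists p, weak_cut K [set r] r 0 p.
Proof.
case: K => [|[|K]] // _.
  (* For K = 1 a leftover would have to be empty, so the single vertex pays for [f r = 0]. *)
  exists 0%N; apply: (@WeakClosed _ _ _ _ _ [:: delta R r]); rewrite ?cards1 //.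
  move=> f /andP[]; rewrite ip_delta => /eqP f0 _; split=> //.
  by rewrite mass1 f0 expr0n mulr0 form_ge0.
exists 1%N; apply: (@WeakResidual _ _ _ _ _ [::] [set r]);
  rewrite ?cards1 ?muln0 //.
by apply: residual_self; [exact: conn1 | rewrite inE].
Qed.

(** A leftover is smaller than [S], so some condition was imposed and the leftover is attached with
    weight 1: [form_anchor] settles it. Counting vertices bounds the number of conditions. *)
Lemma weak_cut_finish S r d p n K : (0 < K)%N -> path_ineq a 1 K.-1 ->
  (1 < n)%N ->
  (K <= #|S|)%N -> (#|S| < n * K + d)%N -> weak_cut K S r d p ->
  exists2 L, (size L < n)%N & forall f, orth L f -> a * mass S f <= form S f.
Proof.
move=> K0 aK n1 KS Sn [L H L0 _ sL|L P H LS _ PK sL].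
  by exists L => [|f /H[]] //; nia.
have L0 : (0 < size L)%N.
  by rewrite lt0n; apply: contraTneq PK => /size0nil/LS ->; rewrite -leqNgt.
move: H; rewrite L0 => -[rP PS cP H];
  have P0 : (0 < #|P|)%N by apply/card_gt0P; exists r.
exists L => [|f /H[y yP E]]; first by nia.
have PK' : (#|P| <= K.-1)%N by rewrite -ltnS prednK.
have := form_anchor e_sym f ler01 aK cP PK' yP; move: E; rewrite !mul1r mulrBr;
  lra.
Qed.

(** * Cuts when the number of vertices is a multiple of n *)

Section ExactCut.
Variables (n k : nat).
Hypotheses (n_gt1 : (1 < n)%N) (k_gt0 : (0 < k)%N) (ak : path_ineq a (path_top
  R n) k).

Let ak1 : path_ineq a 1 k.-1.
Proof. by case: k k_gt0 ak => // k' _; exact: path_ineq_pred. Qed.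

Let top_ge0 : 0 <= path_top R n.
Proof. by rewrite -cut_weight_top // cut_weight_ge0 //; lia. Qed.

(** The tight case: every condition accounts for exactly k vertices, none is spared, and the
    leftover may have k vertices itself. *)
Definition exact_cut S r := exists L P,
  [/\ residual S r P L (cut_weight R n (size L)), (k * size L + #|P| = #|S|)%N &
      (0 < #|P| <= k)%N].

Lemma exact_cut_lt S L (P : {set I}) : (#|S| <= n * k)%N ->
  (k * size L + #|P| = #|S|)%N -> (0 < #|P|)%N -> (size L < n)%N.
Proof. by move=> Sn sE P0; nia. Qed.

Lemma exact_cut_delta S r L P : (#|S| <= n * k)%N ->
  residual S r P L (cut_weight R n (size L)) -> (k * size L + #|P| = #|S|)%N ->
  (0 < #|P| <= k)%N -> closed_cut S r (delta R r :: L).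
Proof.
move=> Sn [rP PS cP H] sE /andP[P0 Pk] f /andP[].
rewrite ip_delta => /eqP f0 /H[y yP E]; split=> //.
have := form_anchor e_sym f top_ge0 ak cP Pk rP; rewrite f0 expr0n mulr0 addr0.
move: E; rewrite mulrBr; have := cut_weight_ge0 R n_gt1 (exact_cut_lt Sn sE P0).
by move=> /mulr_ge0 /(_ (sqr_ge0 (f y : R))); lra.
Qed.

(** A leftover of k vertices pays for [f r = 0]; a smaller one keeps its attachment, whose weight is
    at least 1 once a condition has been imposed. *)
Lemma exact_weak_cut S r : (#|S| <= n * k)%N -> exact_cut S r ->
  exists p, weak_cut k S r 0 p.
Proof.
move=> Sn [L [P [H sE Pk]]]; have /andP[P0] := Pk.
rewrite leq_eqVlt => /orP[/eqP PE|Pk'].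
  exists 0%N; apply: (@WeakClosed _ _ _ _ _ (delta R r :: L)) => //.
    exact: exact_cut_delta sE Pk.
  by rewrite /= mulnS addn0 -sE PE addnC.
exists #|P|; apply: (@WeakResidual _ _ _ _ _ L P) => //;
  last by rewrite addn0 sE.
  apply: residual_weight H; have zn := exact_cut_lt Sn sE P0.
  by case: (size L) zn => [|z] zn; rewrite ?cut_weight_ge0 ?cut_weight_ge1.
move=> L0; case: H => _ PS _ _; apply/eqP; rewrite eqEcard PS -sE L0 /=.
by rewrite muln0.
Qed.

(** The condition [g] makes the interpolation of [f] along the edge [r1 r2] vanish at an interior
    point. The half-edge at [r2] raises the attachment of [P] to [path_top] by [cut_weight_balance];
    the half-edge at [r1] has the next cut weight. *)
Lemma exact_absorb S r1 r2 L P : (k * size L + #|P| = #|S|)%N -> #|P| = k ->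
  ((size L).+1 < n)%N -> residual S r2 P L (cut_weight R n (size L)) ->
  exists g, forall f, orth (g :: L) f ->
    a * mass S f + cut_weight R n (size L).+1 * (f r1 : R) ^+ 2
      <= form S f + ((f r1 : R) - (f r2 : R)) ^+ 2.
Proof.
set z := size L; move=> sE PE zn [rP PS cP H].
pose X := cut_vec R n.
have X0 : 0 < X z by rewrite cut_vec_gt0 // ltnW.
have X1 : 0 < X z.+1 by rewrite cut_vec_gt0.
exists (X z *: delta R r1 + X z.+1 *: delta R r2) => f /andP[].
rewrite ipDl !ipZl !ip_delta => /eqP f12 /H[y1 y1P E].
have w10 : 0 <= cut_weight R n z by rewrite cut_weight_ge0 // ltnW.
have w20 : 0 <= 1 + X z.+1 / X z by rewrite addr_ge0 // divr_ge0 // ltW.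
have [|y yP Ey] := weight_min_ex f (w := path_top R n) w10 w20 _ y1P rP.
  by rewrite cut_weight_balance // ltnW.
have := form_anchor e_sym f top_ge0 ak cP (eq_leq PE) yP.
rewrite cut_weightS // -/X.
have : ((f r1 : R) - (f r2 : R)) ^+ 2 = (1 + X z.+1 / X z) * (f r2 : R) ^+ 2
    + (1 + X z / X z.+1) * (f r1 : R) ^+ 2.
  have -> : (f r2 : R) = - (X z / X z.+1 * (f r1 : R)).
    by apply: (mulfI (lt0r_neq0 X1));
      rewrite mulrN mulrCA mulrA divfK ?gt_eqF //; lra.
  by field; rewrite !gt_eqF.
by move: E Ey; rewrite mulrBr; lra.
Qed.

(** One spare vertex suffices: with [n * k] vertices in all it already forces fewer than n
    conditions. *)
Definition exact_or_weak S r := (#|S| <= n * k)%N ->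
  exact_cut S r \/ exists p, weak_cut k S r 1 p.

Lemma weak_cut_le S r d d' p : (d' <= d)%N -> weak_cut k S r d p ->
  weak_cut k S r d' p.
Proof.
move=> dd [L H L0 p0 sL|L P H LS pE PK sL]; [apply: (@WeakClosed _ _ _ _ _ L) |
  apply: (@WeakResidual _ _ _ _ _ L P)] => //; lia.
Qed.

(** A spare vertex on either side survives. For two exact cuts: leftovers fitting into k vertices
    are merged; a full [P2] is detached by cutting the edge [r1 r2]; otherwise [f r1 = 0] consumes
    more than k vertices, which yields a spare one. *)
Lemma exact_or_weakU S1 S2 r1 r2 :
  [disjoint S1 & S2] -> e r1 r2 -> r1 \in S1 -> r2 \in S2 ->
  exact_or_weak S1 r1 -> exact_or_weak S2 r2 -> exact_or_weak (S1 :|: S2) r1.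
Proof.
move=> dS r12 r1S r2S Q1 Q2 Sn.
have cS : #|S1 :|: S2| = (#|S1| + #|S2|)%N.
  by apply/eqP; rewrite (leq_card_setU S1 S2).2.
have Sn1 : (#|S1| <= n * k)%N by lia.
have Sn2 : (#|S2| <= n * k)%N by lia.
have weak d1 p1 d2 p2 : weak_cut k S1 r1 d1 p1 -> weak_cut k S2 r2 d2 p2 ->
    (0 < d1 + d2)%N -> exists p, weak_cut k (S1 :|: S2) r1 1 p.
  move=> W1 W2 d12; have [p W] := weak_cutU k_gt0 ak1 dS r12 r1S r2S W1 W2.
  by exists p; apply: weak_cut_le W.
case: (Q1 Sn1) (Q2 Sn2) => [X1|[p1 W1]] [X2|[p2 W2]]; first last.
- by right; apply: weak W1 W2 _.
- by have [p2 W2] := exact_weak_cut Sn2 X2; right; apply: weak W1 W2 _.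
- by have [p1 W1] := exact_weak_cut Sn1 X1; right; apply: weak W1 W2 _.
case: X1 X2 => [L1 [P1 [H1 sE1 Pk1]]] [L2 [P2 [H2 sE2 Pk2]]].
have /andP[P01 P1k] := Pk1; have /andP[P02 P2k] := Pk2.
have zn : (size L1 + size L2 < n)%N by nia.
have w10 : 0 <= cut_weight R n (size L1) by rewrite cut_weight_ge0 //; lia.
have w20 : 0 <= cut_weight R n (size L2) by rewrite cut_weight_ge0 //; lia.
have dP : #|P1 :|: P2| = (#|P1| + #|P2|)%N.
  have [_ PS1 _ _] := H1; have [_ PS2 _ _] := H2.
  by apply/eqP; rewrite (leq_card_setU P1 P2).2 (disjointWl PS1 (disjointWr PS2
    dS)).
have [P12|P12] := leqP (#|P1| + #|P2|) k.
  left; exists (L1 ++ L2), (P1 :|: P2); split.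
  - apply: (residualU dS r12 w10 w20 _ H1 H2); rewrite size_cat.
    exact: cut_weight_subadd.
  - by rewrite size_cat dP cS; lia.
  - by rewrite dP P12 andbT; lia.
move: P2k; rewrite leq_eqVlt => /orP[/eqP P2E|P2k].
  have zn' : (size L1 + (size L2).+1 < n)%N by nia.
  have zn2 : ((size L2).+1 < n)%N by lia.
  have [g Hg] := exact_absorb r1 sE2 P2E zn2 H2.
  left; exists (L1 ++ g :: L2), P1; split=> //; last by rewrite size_cat cS /=;
    nia.
  apply: (residual_absorb dS r12 r2S r1S w10 _ _ H1 Hg).
    by rewrite cut_weight_ge0.
  by rewrite size_cat cut_weight_subadd.
right; exists 0%N; apply: (@WeakClosed _ _ _ _ _ ((delta R r1 :: L1) ++ L2)) =>
  //.
  apply: (closed_cutU dS r12 r2S r1S); first exact: exact_cut_delta sE1 Pk1.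
  by apply: residual_grounded ak1 w20 _ H2; lia.
by rewrite size_cat cS /=; nia.
Qed.

End ExactCut.

Lemma friedman_lt n k : conn setT -> path_ineq a 1 k -> (1 < n)%N ->
  (k < #|I| < n * k.+1)%N ->
  exists2 L, (size L < n)%N & forall f,
    orth L f -> a * mass setT f <= form setT f.
Proof.
move=> cI ak n1 /andP[kI In]; have /card_gt0P[r _] : (0 < #|I|)%N by lia.
(* With K = k + 1, leftovers have at most k vertices, and [#|I| < n * k.+1] leaves room for fewer
   than n conditions. *)
have [p W] : exists p, weak_cut k.+1 setT r 0 p.
  apply: (@conn_ind (fun S r =>
    exists p, weak_cut k.+1 S r 0 p)) cI (in_setT r).
    by move=> x; exact: weak_cut1.
  move=> S1 S2 r1 r2 dS r12 r1S r2S [p1 W1] [p2 W2].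
  exact: (@weak_cutU k.+1 _ ak _ _ _ _ 0 0 _ _ dS r12 r1S r2S W1 W2).
by apply: weak_cut_finish W; rewrite ?cardsT ?addn0 // mulnC.
Qed.

Lemma friedman_eq n k : conn setT -> path_ineq a (path_top R n) k ->
  (1 < n)%N ->
  (0 < k)%N -> #|I| = (n * k)%N ->
  exists2 L, (size L < n)%N & forall f,
    orth L f -> a * mass setT f <= form setT f.
Proof.
move=> cI ak n1 k0 In; have /card_gt0P[r _] : (0 < #|I|)%N by rewrite In; nia.
have ak1 : path_ineq a 1 k.-1 by case: (k) k0 ak => // k' _;
  exact: path_ineq_pred.
have X : exact_or_weak n k setT r.
  apply: (@conn_ind (exact_or_weak n k)) cI (in_setT r) => [x _|].
    left; exists [::], [set x]; rewrite cut_weight0 cards1 muln0; split=> //.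
    by apply: residual_self; [exact: conn1 | rewrite inE].
  exact: exact_or_weakU.
have [|[L [P [H sE /andP[P0 Pk]]]]|[p W]] := X; first by rewrite cardsT In.
  2: by apply: weak_cut_finish W; rewrite ?cardsT ?In ?addn1 //; nia.
rewrite cardsT In in sE.
(* An exact cut of all [n * k] vertices ends with n - 1 conditions, where the attachment of the last
   piece has reached [path_top]. *)
have zE : size L = n.-1 by nia.
exists L => [|f]; first by lia.
case: H => _ PS cP H /H[y yP]; rewrite zE cut_weight_top // mulrBr.
have top_ge0 : 0 <= path_top R n by rewrite -cut_weight_top // cut_weight_ge0
  //; lia.
by have := form_anchor e_sym f top_ge0 ak cP Pk yP; lra.
Qed.

End Cutting.

(** * Dirichlet and Neumann Laplacians *)

Section UnitMeasure.
Variables (R : realType) (V : finType) (w : V -> V -> R).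
Hypothesis w_sym : forall x y, w x y = w y x.
Implicit Types (S : {set V}) (u v : fspace R V).

Local Notation m := (@unit_measure R V).

Lemma laplaceE u x : laplace m w u x = \sum_y ((u x : R) - u y) * w x y.
Proof. by rewrite lfunE /= ffunE /lapl invr1 mul1r. Qed.

(** Green's formula: average the double sum with its copy in which x and y are exchanged. *)
Lemma ip_laplace u v : ip (laplace m w u) v =
  (\sum_x \sum_y ((u x : R) - u y) * ((v x : R) - v y) * w x y) / 2.
Proof.
pose F x y : R := ((u x : R) - u y) * w x y * v x.
have E1 : ip (laplace m w u) v = \sum_x \sum_y F x y.
  by apply: eq_bigr => x _; rewrite laplaceE mulr_suml.
have E2 : ip (laplace m w u) v = \sum_x \sum_y F y x by rewrite E1 exchange_big.
apply: (mulIf (_ : 2 != 0)); rewrite ?pnatr_eq0 // divfK ?pnatr_eq0 //.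
rewrite mulr_natr mulr2n {1}E1 E2 -big_split; apply: eq_bigr => x _ /=.
by rewrite -big_split; apply: eq_bigr => y _ /=; rewrite /F (w_sym y x); ring.
Qed.

Lemma symmetric_laplace : symmetric_op (laplace m w).
Proof.
move=> u v; rewrite (ipC u) !ip_laplace; congr (_ / 2).
by apply: eq_bigr => x _; apply: eq_bigr => y _;
  rewrite (mulrC (_ - _) (_ - _)).
Qed.

Lemma ext0_val S (u : fspace R (sub_of S)) y : ext0 u (val y) = u y.
Proof. by rewrite ffunE valK. Qed.

Lemma ext0_out S (u : fspace R (sub_of S)) x : x \notin S -> ext0 u x = 0.
Proof. by move=> xS; rewrite ffunE insubN. Qed.

Lemma ext0_out_val S (u : fspace R (sub_of S)) (x : sub_of (~: S)) :
  ext0 u (val x) = 0.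
Proof. by apply: ext0_out; have := valP x; rewrite inE. Qed.

Lemma sum_sub S (F : V -> R) : \sum_(x in S) F x = \sum_(x : sub_of S) F (val
  x).
Proof. exact: big_sub. Qed.

Lemma sum_ext0 S (u : fspace R (sub_of S)) (F : V -> R) :
  \sum_x F x * ext0 u x = \sum_(x : sub_of S) F (val x) * u x.
Proof.
rewrite (bigID (mem S)) /= [X in _ + X]big1 ?addr0 => [|x xS].
  by rewrite sum_sub; apply: eq_bigr => x _; rewrite ext0_val.
by rewrite ext0_out // mulr0.
Qed.

Lemma ext_laplaceE S (u : fspace R (sub_of S)) x :
  ext_laplace m w S u x = laplace m w (ext0 u) (val x).
Proof. by rewrite !lfunE /= ffunE. Qed.

Lemma ip_ext_laplace S (u v : fspace R (sub_of S)) :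
  ip (ext_laplace m w S u) v = ip (laplace m w (ext0 u)) (ext0 v).
Proof.
rewrite /ip (sum_ext0 v); apply: eq_bigr => x _; congr (_ * _).
exact: ext_laplaceE.
Qed.

Lemma symmetric_ext_laplace S : symmetric_op (ext_laplace m w S).
Proof.
by move=> u v; rewrite ip_ext_laplace symmetric_laplace ipC -ip_ext_laplace ipC.
Qed.

Lemma adjE S S' (u : fspace R (sub_of S)) x :
  adj m w S S' u x = \sum_y (u y : R) * w (val x) (val y).
Proof. by rewrite lfunE /= ffunE /adjf invr1 mul1r. Qed.

Lemma ip_adj S S' (u : fspace R (sub_of S)) (v : fspace R (sub_of S')) :
  ip (adj m w S S' u) v = ip u (adj m w S' S v).
Proof.
rewrite /ip; under eq_bigr => x _ do rewrite adjE mulr_suml.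
under [RHS]eq_bigr => x _ do rewrite adjE mulr_sumr.
rewrite exchange_big; apply: eq_bigr => x _; apply: eq_bigr => y _ /=.
by rewrite (w_sym (val x)) mulrAC mulrA.
Qed.

Lemma laplace_ext0_out S S' (u : fspace R (sub_of S)) (x : sub_of S') :
  ext0 u (val x) = 0 -> laplace m w (ext0 u) (val x) = - adj m w S S' u x.
Proof.
move=> ux; rewrite laplaceE adjE -sumrN.
rewrite [RHS](eq_bigr (fun y => - w (val x) (val y) * (u y : R))) => [|y _];
  last by ring.
rewrite -(sum_ext0 u (fun y => - w (val x) y)).
by apply: eq_bigr => y _; rewrite ux sub0r mulNr mulrC mulNr.
Qed.

End UnitMeasure.

(** * Both Laplacians as shifts of the interior Laplacian *)

Section GraphWithBoundary.
Variables (R : realType) (V : finType) (e : rel V) (B : {set V}).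
Hypothesis e_sym : symmetric e.

Local Notation m := (@unit_measure R V).
Local Notation w := (unit_weight R e).
Local Notation Om := (~: B).
Local Notation eO := (induced e Om).
Local Notation mO := (@unit_measure R (sub_of Om)).
Local Notation wO := (unit_weight R eO).

Let w_sym x y : w x y = w y x.
Proof. by rewrite /unit_weight e_sym. Qed.

Let eO_sym : symmetric eO.
Proof. by move=> x y; rewrite /induced e_sym. Qed.

Let wO_sym x y : wO x y = wO y x.
Proof. by rewrite /unit_weight eO_sym. Qed.

Lemma mul_opE (T : finType) (d u : fspace R T) x :
  mul_op d u x = (d x : R) * (u x : R).
Proof. by rewrite lfunE ffunE. Qed.

Lemma degBE x : degB m w B x = \sum_(y in B) w (val x) y.
Proof. by rewrite ffunE invr1 mul1r. Qed.

Lemma dirichlet_laplaceE :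
  dirichlet_laplace m w B = laplace mO wO + mul_op (degB m w B).
Proof.
apply/lfunP => u; apply/ffunP => x;
  transitivity (laplace m w (ext0 u) (val x)); first exact: ext_laplaceE.
rewrite laplaceE add_lfunE [RHS]ffunE laplaceE mul_opE degBE (bigID (mem Om))
  /=.
rewrite sum_sub; congr (_ + _).
  by apply: eq_bigr => y _; rewrite !ext0_val.
rewrite mulr_suml; apply: eq_big => [y|y]; rewrite ?inE ?negbK // => yB.
by rewrite ext0_val ext0_out ?inE ?yB // subr0 mulrC.
Qed.

Lemma ip_laplace_form (T : finType) (q : rel T) (u : fspace R T) : symmetric q
  ->
  ip (laplace (@unit_measure R T) (unit_weight R q) u) u = form q setT u.
Proof.
move=> q_sym; rewrite ip_laplace; last by move=> x y;
  rewrite /unit_weight q_sym.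
congr (_ / 2); apply: eq_big => [x|x _]; rewrite ?inE //.
by apply: eq_big => [y|y _]; rewrite ?inE // -expr2 mulrC.
Qed.

Lemma massT (T : finType) (f : fspace R T) : mass setT f = ip f f.
Proof. by apply: eq_big => [x|x _]; rewrite ?inE. Qed.

Lemma eig_shift_ge (X Y : 'End(fspace R (sub_of Om))) L (a : R) (i j : nat) :
  X = laplace mO wO + Y -> symmetric_op Y ->
  (0 < j)%N -> (size L + j <= i <= #|Om|)%N ->
  (forall f, orth L f -> a * mass setT f <= form eO setT f) ->
  a + eig Y j <= eig X i.
Proof.
move=> XE symY j0 /andP[Lij iO] La.
have cO : #|{: sub_of Om}| = #|Om| by rewrite card_sig.
have symX : symmetric_op X.
  by move=> u v; rewrite XE !add_lfunE ipDl ipDr symmetric_laplace // symY.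
have [|L' L'j HL'] := eig_le_form (i := j) symY; first by rewrite j0 cO; lia.
(* [L'] has at most j - 1 members, so fewer than i conditions are imposed in all. *)
apply: (@eig_ge _ _ X (L ++ L')) => //; first by rewrite size_cat cO; lia.
move=> f; rewrite orth_cat => /andP[/La + /HL'];
  rewrite massT XE add_lfunE ipDl mulrDl.
by rewrite ip_laplace_form //; exact: lerD.
Qed.

Hypotheses (e_conn : connected_graph e) (Om_neq0 : Om != set0).

(** The extension of a kernel element has zero energy, so it is constant along edges; it vanishes at
    an interior vertex, hence everywhere by connectivity. *)
Lemma ext_laplace_boundary_inj : lker (ext_laplace m w B) == 0%VS.
Proof.
rewrite -subv0; apply/subvP => f; rewrite memv_ker memv0 => /eqP f0.
have E : form e setT (ext0 f) = 0.
  by rewrite -ip_laplace_form // -ip_ext_laplace f0 ipC ip0r.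
have fe x y : e x y -> (ext0 f x : R) = ext0 f y.
  move=> xy; have := cross_edge (ext0 f) (in_setT x) (in_setT y) xy.
  have -> : cross e setT setT (ext0 f) = 0.
    by move/eqP: E; rewrite mulf_eq0 invr_eq0 pnatr_eq0 orbF => /eqP.
  by rewrite real_exprn_even_le0 ?num_real //= subr_eq0 => /eqP.
have [r rO] := set0Pn _ Om_neq0.
apply/eqP/ffunP => x; rewrite [RHS]ffunE -ext0_val; apply/eqP;
  apply: contraT => fx.
have fr : ext0 f r == 0 by rewrite ext0_out //; move: rO; rewrite inE.
have [u [v [uv /eqP u0 /eqP[]]]] :=
  connect_cross (b := fun z => ext0 f z == 0) (e_conn r (val x)) fr fx.
by rewrite -(fe u v).
Qed.

Local Notation L_B := (ext_laplace m w B).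

Lemma symmetric_inv_ext_laplace : symmetric_op (L_B^-1)%VF.
Proof.
move=> u v; have LK := lker0_lfunVK ext_laplace_boundary_inj.
by rewrite -{1}(LK v) -(symmetric_ext_laplace w_sym) LK.
Qed.

Lemma deg_adj_opE u :
  deg_adj_op m w B u = mul_op (degB m w B) u
    - adj m w B Om ((L_B^-1)%VF (adj m w Om B u)).
Proof. by rewrite add_lfunE opp_lfunE !comp_lfunE. Qed.

Lemma symmetric_deg_adj_op : symmetric_op (deg_adj_op m w B).
Proof.
move=> u v; rewrite !deg_adj_opE ipDl ipDr ipNl ipNr symmetric_mul_op;
  congr (_ - _).
by rewrite ip_adj // symmetric_inv_ext_laplace ip_adj.
Qed.

(** Harmonicity on [B] is the equation L_B h = A_Omega u for the boundary values h. Two solutions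
    differ by a function supported on [B] and killed by L_B. *)
Lemma N0E u : N0 m w u = ext0 u + ext0 ((L_B^-1)%VF (adj m w Om B u)).
Proof.
set h := (L_B^-1)%VF _; set v : fspace R V := _ + _.
have LK := lker0_lfunVK ext_laplace_boundary_inj.
have laplE (f : fspace R V) x : lapl m w f x = laplace m w f x by rewrite lfunE
  /= ffunE.
have ext0u_B (x : sub_of B) : ext0 u (val x) = 0.
  by rewrite ext0_out // inE negbK (valP x).
have v_N0 : is_N0 m w u v.
  split; first by apply/ffunP => x;
    rewrite [LHS]ffunE [LHS]ffunE ext0_val ext0_out_val addr0.
  move=> x xB; rewrite laplE linearD [LHS]ffunE /=.
  rewrite -[x]/(val (Sub x xB : sub_of B)).
  rewrite (laplace_ext0_out w (ext0u_B _)) -ext_laplaceE LK addNr //.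
(* As [v] is a solution, [N0] returns a solution and not an arbitrary default. *)
have N0P : is_N0 m w u (N0 m w u) by apply: classical_sets.xgetPex; exists v.
apply/eqP; rewrite -subr_eq0; set d : fspace R V := _ - _.
have dE : d = ext0 (restr B d).
  apply/ffunP => x; have [xB|xB] := boolP (x \in B).
    by rewrite -[x]/(val (Sub x xB : sub_of B)) ext0_val [RHS]ffunE.
  have xO : x \in Om by rewrite inE.
  rewrite ext0_out // -[x]/(val (Sub x xO : sub_of Om)).
  have := congr1 (fun g : fspace R (sub_of Om) =>
    g (Sub x xO)) (etrans N0P.1 (esym v_N0.1)).
  by rewrite !ffunE => ->; rewrite subrr.
have d0 : L_B (restr B d) = 0.
  apply/ffunP => x; rewrite ext_laplaceE -dE linearB [LHS]ffunE [X in _ +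
    X]ffunE [RHS]ffunE.
  by rewrite -!laplE N0P.2 ?v_N0.2 ?(valP x) // subrr.
have : restr B d \in lker L_B by rewrite memv_ker d0.
rewrite (eqP ext_laplace_boundary_inj) memv0 => /eqP r0.
by rewrite dE r0; apply/eqP/ffunP => x; rewrite !ffunE; case: insubP => // y;
  rewrite ffunE.
Qed.

Lemma neumann_laplaceE :
  neumann_laplace m w B = laplace mO wO + deg_adj_op m w B.
Proof.
rewrite /deg_adj_op addrA -dirichlet_laplaceE.
set C := (adj m w B Om \o _)%VF; set T := _ - _.
(* Identifying the function with a linear map comes first, because [linfun] is meaningful only on
   linear functions. *)
suff E : neumann_fun m w (B := B) = T.
  by rewrite /neumann_laplace E; apply/lfunP => u; rewrite lfunE.
apply: boolp.funext => u; apply/ffunP => x.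
have CE : C u = adj m w B Om ((L_B^-1)%VF (adj m w Om B u)) by rewrite
  !comp_lfunE.
rewrite /T add_lfunE opp_lfunE CE [RHS]ffunE [X in _ + X]ffunE.
rewrite -laplace_ext0_out; last by apply: ext0_out; have := valP x; rewrite inE.
rewrite [dirichlet_laplace _ _ _ _ _]ext_laplaceE /neumann_fun N0E [LHS]ffunE.
have -> (f : fspace R V) : laplace_fun m w f = laplace m w f by rewrite lfunE.
by rewrite linearD [LHS]ffunE.
Qed.

End GraphWithBoundary.

(** * Eigenvalues of paths *)

Section PathGraph.
Variable R : realType.

Lemma sum_path_rel n (H : nat -> nat -> R) : (forall x y, H x y = H y x) ->
  (\sum_(x < n.+1) \sum_(y < n.+1) (@path_rel n.+1 x y)%:R * H x y) / 2
    = \sum_(l < n) H l l.+1.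
Proof.
move=> Hsym.
have E : \sum_(x < n.+1) \sum_(y < n.+1) (x.+1 == y)%:R * H x y = \sum_(l < n)
  H l l.+1.
  rewrite exchange_big big_ord_recl /= big1 => [|x _]; last by rewrite mul0r.
  rewrite add0r; apply: eq_bigr => y _;
    rewrite (bigD1 (widen_ord (leqnSn n) y)) //=.
  rewrite eqxx mul1r big1 ?addr0 // => x xy.
  by rewrite /bump /= add1n eqSS (_ : (x == y :> nat) = false) ?mul0r //;
    apply: negbTE.
have E' : \sum_(x < n.+1) \sum_(y < n.+1) (y.+1 == x)%:R * H x y = \sum_(l < n)
  H l l.+1.
  by rewrite exchange_big -E; do 2!apply: eq_bigr => ? _; rewrite Hsym.
apply: (mulIf (_ : 2 != 0)); rewrite ?pnatr_eq0 // divfK ?pnatr_eq0 //.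
rewrite mulr_natr mulr2n -{1}E -E' -big_split; apply: eq_bigr => x _ /=.
rewrite -big_split; apply: eq_bigr => y _ /=; rewrite -mulrDl /path_rel.
have : ~~ ((x.+1 == y) && (y.+1 == x)) by apply/negP => /andP[/eqP <- /eqP];
  lia.
by case: (_ == _ :> nat) => /=; [move=> /negbTE ->;
  rewrite addr0 | rewrite add0r].
Qed.

Lemma path_rel_sym n : symmetric (@path_rel n).
Proof. by move=> x y; rewrite /path_rel orbC. Qed.

(** The fewer than n conditions given by [eig_le_form] leave a nonzero [f] with Rayleigh quotient at
    least the top eigenvalue; [path_form_le_top] bounds that quotient above. *)
Lemma path_mu_le_top n : (1 < n)%N ->
  mu (@unit_measure R 'I_n) (unit_weight R (@path_rel n)) n <= path_top R n.
Proof.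
case: n => // n n1.
have symT : symmetric_op (laplace (@unit_measure R 'I_n.+1) (unit_weight R
  (@path_rel n.+1))).
  by apply: symmetric_laplace => x y; rewrite /unit_weight path_rel_sym.
have [|L Ln HL] := eig_le_form (i := n.+1) symT;
  first by rewrite card_ord leqnn.
have [|f f0 /HL Hf] := @exists_orth R 'I_n.+1 L; first by rewrite card_ord.
rewrite -(ler_pM2r (ip_gt0 f0)); apply: le_trans Hf _.
rewrite ip_laplace_form; last exact: path_rel_sym.
pose g l := f (inord l) : R.
have fg (x : 'I_n.+1) : (f x : R) = g x by rewrite /g inord_val.
have -> : form (@path_rel n.+1) setT f = \sum_(l < n) (g l.+1 - g l) ^+ 2.
  under [RHS]eq_bigr => l _ do rewrite -sqrrN opprB.
  rewrite -(sum_path_rel n (H := fun x y => (g x - g y) ^+ 2)) => [|x y].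
    congr (_ / 2); apply: eq_big => [x|x _]; rewrite ?inE //.
    by apply: eq_big => [y|y _]; rewrite ?inE // !fg.
  by rewrite -sqrrN opprB.
have -> : ip f f = \sum_(l < n.+1) g l ^+ 2.
  by apply: eq_bigr => x _; rewrite fg -expr2.
exact: (path_form_le_top n1 g).
Qed.

Lemma path_ineq_lambda1 (c : R) k : (0 < k)%N ->
  path_ineq (lambda (@unit_measure R 'I_k.+1) (@path_weight R c k.+1) [set
    ord0] 1) c k.
Proof.
move=> k0 g; set w := @path_weight R c k.+1;
  pose B : {set 'I_k.+1} := [set ord0].
have w_sym x y : w x y = w y x by rewrite /w /path_weight path_rel_sym minnC.
have symT : symmetric_op (ext_laplace (@unit_measure R 'I_k.+1) w (~: B)).
  exact: symmetric_ext_laplace.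
have cO : #|{: sub_of (~: B)}| = k.
  by rewrite card_sig; have := cardsC B; rewrite cards1 card_ord add1n => -[].
(* For the lowest eigenvalue the list of conditions is empty, so the bound holds for every
   function. *)
have [|L] := eig_le_form (i := 1) symT; first by rewrite cO k0.
rewrite ltnS leqn0 => /nilP -> HL.
pose f : fspace R (sub_of (~: B)) := [ffun x : sub_of (~: B) =>
  (g (val x).-1 : R^o)].
(* Shift by one: vertex l + 1 carries [g l], and the boundary vertex 0 carries 0. *)
pose G l := if l is l'.+1 then g l' else 0.
have fG x : ext0 f x = G x.
  rewrite ffunE; case: insubP => [y xB yx|]; last first.
    by rewrite /B !inE negbK => /eqP ->.
  move: xB; rewrite ffunE yx /B !inE -val_eqE /=.
  by case: (nat_of_ord x).
have := HL f isT; rewrite ip_ext_laplace ip_laplace //.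
have -> : ip f f = \sum_(l < k) g l ^+ 2.
  transitivity (\sum_x (ext0 f x : R) * ext0 f x).
    by rewrite sum_ext0; apply: eq_bigr => x _; rewrite ext0_val.
  rewrite big_ord_recl fG mul0r add0r; apply: eq_bigr => l _.
  by rewrite fG -expr2.
move=> /le_trans; apply.
pose H x y := (if minn x y == 0%N then c else 1) * (G x - G y) ^+ 2.
have H_sym x y : H x y = H y x by rewrite /H minnC -(sqrrN (G x - _)) opprB.
rewrite le_eqVlt; apply/orP; left; apply/eqP.
transitivity (\sum_(l < k) H l l.+1).
  rewrite -sum_path_rel //; congr (_ / 2); apply: eq_bigr => x _;
    apply: eq_bigr => y _.
  rewrite !fG /w /path_weight /H; case: path_rel;
    rewrite ?mul0r ?mulr0 // mul1r.
  by rewrite mulrC -expr2.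
case: k k0 {w B w_sym symT cO L HL f fG} => // k _; rewrite big_ord_recl /H /=.
rewrite sub0r sqrrN; congr (_ + _); apply: eq_bigr => l _.
by rewrite /bump /= add1n minnSS mul1r -sqrrN opprB.
Qed.

End PathGraph.

Lemma connected_conn (T : finType) (q : rel T) : connected_graph q ->
  conn q setT.
Proof.
move=> cq x y _ _; apply: connect_sub (cq x y) => u v uv.
by apply: connect1; rewrite /within !inE.
Qed.

Unset Implicit Arguments.

Theorem theorem6p8 (R : realType) (V : finType) (e : rel V) (B : {set V})
    (i j : nat) :
  symmetric e -> irreflexive e -> connected_graph e ->
  B != set0 -> connected_graph (induced e (~: B)) ->
  (2 <= i <= #|~: B|)%N -> (1 <= j <= i - 1)%N ->
  let m : V -> R := @unit_measure R V in
  let w : V -> V -> R := unit_weight R e in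
  let n := (i - j + 1)%N in
  let k := (#|~: B| %/ n)%N in
  let c : R := mu (@unit_measure R 'I_n) (unit_weight R (@path_rel n)) n in
  let lambda1P : R :=
    lambda (@unit_measure R 'I_k.+1) (@path_weight R c k.+1) [set ord0] 1 in
  (~~ (n %| #|~: B|)%N ->
     2 * (1 - cos (pi / (2 * k + 1)%:R)) + degB_sorted m w B j
       <= lambda m w B i
     /\
     2 * (1 - cos (pi / (2 * k + 1)%:R)) + eig (deg_adj_op m w B) j
       <= nu m w B i)
  /\
  ((n %| #|~: B|)%N ->
     lambda1P + degB_sorted m w B j <= lambda m w B i
     /\
     lambda1P + eig (deg_adj_op m w B) j <= nu m w B i).
Proof.
move=> e_sym _ e_conn B0 O_conn /andP[i2 iO] /andP[j1 ji] m w n k c lambda1P.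
have n1 : (1 < n)%N by rewrite /n; lia.
have nO : (n <= #|~: B|)%N by rewrite /n; lia.
have k0 : (0 < k)%N by rewrite divn_gt0 //; lia.
have O0 : ~: B != set0 by rewrite -card_gt0; lia.
have cO : #|{: sub_of (~: B)}| = #|~: B| by rewrite card_sig.
have eO_sym : symmetric (induced e (~: B)) by move=> x y;
  rewrite /induced e_sym.
(* At most n - 1 = i - j conditions on the interior graph give the Dirichlet and the Neumann bound
   at once, with the same [a]. *)
have bounds (a : R) : (exists2 L : seq (fspace R (sub_of (~: B))),
  (size L < n)%N &
    forall f, orth L f -> a * mass setT f <= form (induced e (~: B)) setT f) ->
    a + degB_sorted m w B j <= lambda m w B i /\
    a + eig (deg_adj_op m w B) j <= nu m w B i.
  move=> [L Ln HL]; have Lij : (size L + j <= i <= #|~: B|)%N.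
    by move: Ln; rewrite /n; lia.
  split.
    rewrite /degB_sorted -eig_mul_op.
    have symD : symmetric_op (mul_op (degB m w B)) by exact: symmetric_mul_op.
    exact: (eig_shift_ge e_sym (dirichlet_laplaceE R e B) symD j1 Lij HL).
  have symC : symmetric_op (deg_adj_op m w B) by exact: symmetric_deg_adj_op.
  exact: (eig_shift_ge e_sym (@neumann_laplaceE R V e B e_sym e_conn O0) symC
    j1 Lij HL).
split=> nN; apply: bounds.
  apply: (friedman_lt eO_sym (connected_conn O_conn) (@path_ineq_cos R k k0)
    n1).
  rewrite cO mulnC ltn_ceil ?andbT //; last by lia.
  by rewrite ltn_Pdiv //; lia.
apply: (friedman_eq eO_sym (connected_conn O_conn) _ n1 k0); last first.
  by rewrite cO mulnC divnK.
(* The first edge of the comparison path has weight [c], which is at most [path_top]; a heavier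
   anchor preserves the path inequality. *)
apply: path_ineq_weight (path_ineq_lambda1 c k0).
exact: path_mu_le_top.
Qed.
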